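(* Let $(\mathbf{X}_n)_{n\in\mathbb{Z}_+}$ be an inhomogeneous $d$-type Galton--Watson process with immigration (GWI process) with Bernoulli offspring and immigration distributions, with offspring mean matrices $\mathbf{B}_n$ and immigration mean vectors $\mathbf{m}_n$. Let $\mathbf{A}_{j,n}=(\mathbf{I}-\mathbf{B}_j)\mathbf{B}_{[j,n]}$ for $1\le j\le n$, where $\mathbf{I}$ is the $d\times d$ identity matrix. Suppose that (I1) $\lim_{n\to\infty}\mathbf{B}_n=\mathbf{I}$; (I2) there is an $n_0$ such that $\|\mathbf{B}_n\|<1$ for all $n\ge n_0$; (I3) $\lim_{n\to\infty}\|\mathbf{B}_{[j,n]}\|=0$ for all $j\in\mathbb{N}$; and that at least one of the following two conditions holds: (i) there is an $n_0$ such that $\sup_{n\ge n_0}\frac{\|\mathbf{I}-\mathbf{B}_n\|}{1-\|\mathbf{B}_n\|}<\infty$ or $\mathbf{A}_{j,n}\in\mathbb{R}_+^{d\times d}$ for all $n\ge n_0$ and all $j\in\{1,\dots,n\}$; (ii) there are an orthogonal matrix $\mathbf{U}\in\mathbb{R}^{d\times d}$ and numbers $\varrho_{n,i}$ such that $\mathbf{B}_n=\mathbf{U}\,\mathrm{diag}(\varrho_{n,1},\dots,\varrho_{n,d})\,\mathbf{U}^\top$ for all $n\in\mathbb{N}$. Suppose also that (M) $\lim_{n\to\infty}\mathbf{m}_n(\mathbf{I}-\mathbf{B}_n)^{-1}=\boldsymbol{\lambda}$ for some vector $\boldsymbol{\lambda}$. Then $$\mathbf{X}_n\stackrel{\ma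thcal{D}}{\longrightarrow}\mathrm{Po}(\boldsymbol{\lambda})\qquad(n\to\infty).$$
   Context: Elements of $\mathbb{R}^d$ are row vectors; $\mathbf{e}_1,\dots,\mathbf{e}_d$ is the standard basis. $\|\cdot\|$ is an arbitrary norm on $\mathbb{R}^d$, and for a real $d\times d$ matrix $\|\mathbf{A}\|=\sup_{\|\mathbf{x}\|\le1}\|\mathbf{x}\mathbf{A}\|$; the statement means that if the hypotheses hold for some such norm then the conclusion holds. Inhomogeneous $d$-type GWI process: $\mathbf{X}_0=\mathbf{0}$ and $\mathbf{X}_n=\sum_{i=1}^d\sum_{j=1}^{X_{n-1,i}}\boldsymbol{\xi}_{n,j,i}+\boldsymbol{\varepsilon}_n$ for $n\in\mathbb{N}=\{1,2,\dots\}$, where $\mathbf{X}_n=(X_{n,1},\dots,X_{n,d})$ and $\{\boldsymbol{\xi}_{n,j,i},\boldsymbol{\varepsilon}_n: n,j\in\mathbb{N},\,1\le i\le d\}$ are independent random vectors with values in $\mathbb{Z}_+^d$ such that for each $n,i$ the vectors $\boldsymbol{\xi}_{n,j,i}$, $j\in\mathbb{N}$, are identically distributed. All offspring and immigration means are finite. $\mathbf{B}_n\in\mathbb{R}_+^{d\times d}$ is the matrix whose $i$-th row is $\mathsf{E}\boldsymbol{\xi}_{n,1,i}$, and $\mathbf{m}_n=\mathsf{E}\boldsymbol{\varepsilon}_n$. $\mathbf{B}_{[j,n]}=\mathbf{B}_{j+1}\mathbf{B}_{j+2}\cdots\mathbf{B}_n$ for $0\le j\le n-1$, and $\mathbf{B}_{[n,n]}=\mathbf{I}$.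 (By (I2), $\mathbf{I}-\mathbf{B}_n$ is invertible for $n\ge n_0$.) For $\mathbf{p}=(p_1,\dots,p_d)\in[0,1]^d$ with $p_1+\dots+p_d\le1$, $\mathrm{Be}(\mathbf{p})$ is the distribution on $\{\mathbf{0},\mathbf{e}_1,\dots,\mathbf{e}_d\}$ giving mass $p_i$ to $\mathbf{e}_i$ and $1-\sum_ip_i$ to $\mathbf{0}$. ''Bernoulli offspring'' means that $\boldsymbol{\xi}_{n,1,i}$ has law $\mathrm{Be}(\mathbf{e}_i\mathbf{B}_n)$ for all $n,i$; ''Bernoulli immigration'' means that $\boldsymbol{\varepsilon}_n$ has law $\mathrm{Be}(\mathbf{m}_n)$ for all $n$. $\mathrm{Po}(\boldsymbol{\mu})=\mathrm{Po}(\mu_1)\times\dots\times\mathrm{Po}(\mu_d)$ for $\boldsymbol{\mu}=(\mu_1,\dots,\mu_d)\in[0,\infty)^d$ (independent Poisson components). $\stackrel{\mathcal{D}}{\longrightarrow}$ is convergence in distribution. *)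

(* Defs.v *)
From HB Require Import structures.
From mathcomp Require Import all_boot all_order all_algebra.
From mathcomp Require Import finmap.
From mathcomp Require Import all_classical all_reals all_analysis.

Set Implicit Arguments.
Unset Strict Implicit.
Unset Printing Implicit Defensive.

Import Order.TTheory GRing.Theory Num.Theory.
Import numFieldNormedType.Exports.

Local Open Scope classical_set_scope.
Local Open Scope ring_scope.

(* Z_+^d is 'rV[nat]_d, countable, with the discrete sigma-algebra. *)
HB.instance Definition _ (d : nat) :=
  @isMeasurable.Build default_measure_display 'rV[nat]_d
    discrete_measurable discrete_measurable0
    discrete_measurableC discrete_measurableU.

Definition real_rV (R : realType) (d : nat) (k : 'rV[nat]_d) : 'rV[R]_d :=
  map_mx (fun n : nat => n%:R) k.

Section product_law.
Context {R : realType} (d : nat) (p : 'I_d -> probability nat R).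
Local Open Scope ereal_scope.

(* The product p_1 x ... x p_d: as Z_+^d is countable, the measure of A is the
   sum of the masses of its points; see prod_lawE. *)
Definition prod_law (A : set 'rV[nat]_d) : \bar R :=
  \esum_(k in A) \prod_(i < d) p i [set k ord0 i].

Let mass_ge0 (k : 'rV[nat]_d) : 0 <= \prod_(i < d) p i [set k ord0 i].
Proof. by apply: prode_ge0 => i _; exact: measure_ge0. Qed.

Let prod_law0 : prod_law set0 = 0.
Proof. by rewrite /prod_law esum_set0. Qed.

Let prod_law_ge0 A : 0 <= prod_law A.
Proof. by apply: esum_ge0 => k _; exact: mass_ge0. Qed.

Let prod_law_sigma_additive : semi_sigma_additive prod_law.
Proof.
move=> F mF tF mUF; rewrite /prod_law.
apply: cvg_toP.
  apply: ereal_nondecreasing_is_cvgn => a b ab.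
  apply: lee_sum_nneg_natr => // n _ _.
  by apply: esum_ge0 => k _; exact: mass_ge0.
by rewrite nneseries_sum_bigcup// => k; exact: mass_ge0.
Qed.

HB.instance Definition _ := isMeasure.Build _ _ _ prod_law
  prod_law0 prod_law_ge0 prod_law_sigma_additive.

End product_law.

Section product_law_lemmas.
Context {R : realType}.
Local Open Scope ereal_scope.

Lemma esumZl_fin (T : choiceType) (A : set T) (c : \bar R) (a : T -> \bar R) :
  c \is a fin_num -> 0 <= c -> (forall x, 0 <= a x) ->
  \esum_(x in A) (c * a x) = c * \esum_(x in A) a x.
Proof.
have le_half (r : R) (b : T -> \bar R) : (0 <= r)%R -> (forall x, 0 <= b x) ->
    \esum_(x in A) (r%:E * b x) <= r%:E * \esum_(x in A) b x.
  move=> r0 b0; apply: ge_ereal_sup => _ [F [finF FA] <-].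
  rewrite -ge0_mule_fsumr//; apply: lee_wpmul2l; first by rewrite lee_fin.
  by apply: ereal_sup_ubound; exists F.
move=> /fineK <-; move: (fine c) => r; rewrite lee_fin => r0 a0.
apply/eqP; rewrite eq_le le_half//=.
have [->|rn0] := eqVneq r 0%R.
  by rewrite mul0e; apply: esum_ge0 => x _; rewrite mul0e.
have rgt0 : (0 < r)%R by rewrite lt_neqAle eq_sym rn0.
rewrite -lee_pdivlMl//; apply: le_trans (le_half _ _ _ _).
- by apply: le_esum => x _; rewrite muleA -EFinM mulVf// mul1e.
- by rewrite invr_ge0.
- by move=> x; rewrite mule_ge0// lee_fin.
Qed.

Lemma nat_law_esum (p : probability nat R) (A : set nat) :
  p A = \esum_(n in A) p [set n].
Proof.
have AE : A = \bigcup_(n in A) [set n].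
  by apply/seteqP; split=> [x Ax|x [y Ay ->]//]; exists x.
rewrite {1}AE measure_bigcup//; last first.
  by move=> i j _ _ [x [-> ->]].
by rewrite nneseries_esum ?set_mem_set.
Qed.

Lemma prod_lawE (d : nat) (p : 'I_d -> probability nat R)
    (A : 'I_d -> set nat) :
  prod_law p [set k : 'rV[nat]_d | forall i, A i (k ord0 i)] =
    \prod_(i < d) p i (A i).
Proof.
elim: d => [|d IHd] in p A *.
  have -> : [set k : 'rV[nat]_0 | forall i, A i (k ord0 i)] =
      [set (0%R : 'rV[nat]_0)].
    apply/seteqP; split=> k _ /=; last by case.
    by apply/rowP => -[].
  by rewrite /prod_law esum_set1 ?big_ord0.
pose e (nv : nat * 'rV[nat]_d) : 'rV[nat]_d.+1 :=
  \row_j oapp (nv.2 ord0) nv.1 (unlift ord0 j).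
have e0 nv : e nv ord0 ord0 = nv.1 by rewrite mxE unlift_none.
have eS nv i : e nv ord0 (lift ord0 i) = nv.2 ord0 i by rewrite mxE liftK.
pose B := [set v : 'rV[nat]_d | forall i, A (lift ord0 i) (v ord0 i)].
rewrite /prod_law (@reindex_esum R _ _ (A ord0 `*`` fun=> B) _ e); last first.
  split.
  - move=> [n v] [/= An Bv] j.
    by case: (unliftP ord0 j) => [i|] ->; rewrite ?eS ?e0.
  - move=> [n v] [n' v'] _ _ ee; congr pair.
      by have := congr1 (fun k : 'rV[nat]_d.+1 => k ord0 ord0) ee; rewrite !e0.
    apply/rowP => i.
    have := congr1 (fun k : 'rV[nat]_d.+1 => k ord0 (lift ord0 i)) ee.
    by rewrite !eS.
  - move=> k Ak; exists (k ord0 ord0, \row_i k ord0 (lift ord0 i)).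
      by split=> //= i; rewrite mxE.
    apply/rowP => j; case: (unliftP ord0 j) => [i|] ->; rewrite ?e0//.
    by rewrite eS mxE.
pose q i := p (lift ord0 i).
rewrite (eq_esum (b := fun nv : nat * 'rV[nat]_d => p ord0 [set nv.1] *
    \prod_(i < d) q i [set nv.2 ord0 i])); last first.
  move=> nv _; rewrite big_ord_recl e0; congr (_ * _).
  by apply: eq_bigr => i _; rewrite eS.
have mass_ge0 (v : 'rV[nat]_d) : 0 <= \prod_(i < d) q i [set v ord0 i].
  by apply: prode_ge0 => i _; exact: measure_ge0.
rewrite -(@esum_esum _ _ _ _ _ (fun n (v : 'rV[nat]_d) => p ord0 [set n] *
    \prod_(i < d) q i [set v ord0 i])); last first.
  by move=> n v _ _; rewrite mule_ge0.
have IHB : \esum_(v in B) \prod_(i < d) q i [set v ord0 i] =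
    \prod_(i < d) q i (A (lift ord0 i)) by exact: IHd.
under eq_esum => n _.
  rewrite esumZl_fin//; last exact: fin_num_measure.
  rewrite IHB muleC; over.
rewrite esumZl_fin//.
- by rewrite -nat_law_esum muleC big_ord_recl.
- by rewrite prode_fin_num// => i _; exact: fin_num_measure.
- by apply: prode_ge0 => i _; exact: measure_ge0.
Qed.

End product_law_lemmas.

Section product_law_probability.
Context {R : realType} (d : nat) (p : 'I_d -> probability nat R).

Let prod_law_setT : prod_law p [set: 'rV[nat]_d] = 1%E.
Proof.
rewrite (_ : setT = [set k : 'rV[nat]_d | forall i, [set: nat] (k ord0 i)]).
  by rewrite (prod_lawE p (fun=> setT)) big1// => i _; exact: probability_setT.
by apply/seteqP; split.
Qed.

HB.instance Definition _ :=
  @Measure_isProbability.Build _ _ R (prod_law p) prod_law_setT.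

End product_law_probability.

(* For a nonpositive rate the library's poisson_prob is the point mass at 0, so
   zero rates are covered; its second argument is unused. *)
Definition Poisson (R : realType) (d : nat) (mu : 'rV[R]_d) :
    probability 'rV[nat]_d R :=
  prod_law (fun i => poisson_prob (mu ord0 i) 0%N : probability nat R).

(* has_law Y (Bernoulli p) forces p_i >= 0 and \sum_i p_i <= 1: these are the
   masses, and one minus the mass of 0, under the law of Y. *)
Definition Bernoulli (R : realType) (d : nat) (p : 'rV[R]_d)
    (A : set 'rV[nat]_d) : \bar R :=
  (\sum_(i < d) (p ord0 i)%:E * \d_(delta_mx ord0 i : 'rV[nat]_d) A
   + (1 - \sum_(i < d) p ord0 i)%:E * \d_(0%R : 'rV[nat]_d) A)%E.

Section gwi.
Context {dsp : measure_display} {T : measurableType dsp} {R : realType}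
  (P : probability T R).

Definition mutually_independent (I : choiceType) (D : set I)
    dsp' (E : measurableType dsp') (Y : I -> {RV P >-> E}) : Prop :=
  forall (J : {fset I}) (A : I -> set E), [set` J] `<=` D ->
    (forall i, measurable (A i)) ->
    P (\bigcap_(i in [set` J]) Y i @^-1` A i)
    = (\prod_(i <- J) P (Y i @^-1` A i))%E.

Variable d : nat.
Implicit Types (Y : {RV P >-> 'rV[nat]_d}).

Definition component Y (k : 'I_d) : T -> R := fun w => (Y w ord0 k)%:R.

Definition mean_vec Y : 'rV[R]_d := \row_k fine ('E_P[component Y k])%E.

Definition finite_mean Y : Prop := forall k, ('E_P[component Y k] < +oo)%E.

Variables (xi : nat -> nat -> 'I_d -> {RV P >-> 'rV[nat]_d})
  (eps : nat -> {RV P >-> 'rV[nat]_d}).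

Definition gwi_family (t : (nat * nat * 'I_d) + nat) : {RV P >-> 'rV[nat]_d} :=
  match t with
  | inl (n, j, i) => xi n j i
  | inr n => eps n
  end.

Definition gwi_index : set ((nat * nat * 'I_d) + nat)%type :=
  [set t | match t with
           | inl (n, j, _) => (0 < n)%N && (0 < j)%N
           | inr n => (0 < n)%N
           end].

(* The time n and the label j run over {1, 2, ...}: the values of xi and eps at
   index 0 are irrelevant. *)
Record is_GWI (X : nat -> {RV P >-> 'rV[nat]_d}) : Prop := {
  gwi_indep : mutually_independent gwi_index gwi_family ;
  gwi_ident : forall n j i A, (0 < n)%N -> (0 < j)%N -> measurable A ->
    distribution P (xi n j i) A = distribution P (xi n 1%N i) A ;
  gwi_offspring_mean : forall n i, (0 < n)%N -> finite_mean (xi n 1%N i) ;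
  gwi_immigration_mean : forall n, (0 < n)%N -> finite_mean (eps n) ;
  gwi_init : forall w, X 0%N w = 0 ;
  gwi_step : forall n w, X n.+1 w =
    \sum_(i < d) \sum_(1 <= j < (X n w ord0 i).+1) xi n.+1 j i w + eps n.+1 w }.

Definition offspring_mean (n : nat) : 'M[R]_d :=
  \matrix_(i < d) mean_vec (xi n 1%N i).

Definition immigration_mean (n : nat) : 'rV[R]_d := mean_vec (eps n).

Definition has_law Y (mu : set 'rV[nat]_d -> \bar R) : Prop :=
  forall A, measurable A -> distribution P Y A = mu A.

Definition Bernoulli_offspring : Prop :=
  forall n i, (0 < n)%N -> has_law (xi n 1%N i) (Bernoulli (row i (offspring_mean n))).

Definition Bernoulli_immigration : Prop :=
  forall n, (0 < n)%N -> has_law (eps n) (Bernoulli (immigration_mean n)).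

(* Weak convergence of the laws, seen as laws on R^d. *)
Definition cvg_in_distribution (X : nat -> {RV P >-> 'rV[nat]_d})
    (mu : probability 'rV[nat]_d R) : Prop :=
  forall f : 'rV[R]_d -> R, continuous f -> (exists M : R, forall x, `|f x| <= M) ->
    ('E_P[(fun w => f (real_rV R (X n w)))] @[n --> \oo]
      --> \int[mu]_k (f (real_rV R k))%:E)%E.

End gwi.

Section matrices.
Context {R : realType} {d : nat}.

Record is_norm (N : 'rV[R]_d -> R) : Prop := {
  norm_definite : forall x, N x = 0 -> x = 0 ;
  norm_homogeneous : forall a x, N (a *: x) = `|a| * N x ;
  norm_triangle : forall x y, N (x + y) <= N x + N y }.

(* Row-vector convention: matrices act on the right. *)
Definition opnorm (N : 'rV[R]_d -> R) (A : 'M[R]_d) : R :=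
  sup [set N (x *m A) | x in [set x | N x <= 1]].

(* B_[j,n] = B_(j+1) B_(j+2) ... B_n, in this order; B_[n,n] is the identity. *)
Definition mean_prod (B : nat -> 'M[R]_d) (j n : nat) : 'M[R]_d :=
  \prod_(j.+1 <= k < n.+1) B k.

Definition A_mx (B : nat -> 'M[R]_d) (j n : nat) : 'M[R]_d :=
  (1%:M - B j) *m mean_prod B j n.

End matrices.

(* Main.v *)
Require Import Defs.
From mathcomp Require Import finmap.
From mathcomp Require Import all_boot all_order all_algebra.
From mathcomp Require Import all_classical all_reals all_analysis.
From mathcomp Require Import measurable_realfun ring lra.

Set Implicit Arguments.
Unset Strict Implicit.
Unset Printing Implicit Defensive.

Import Order.TTheory GRing.Theory Num.Theory.
Import numFieldNormedType.Exports.

Local Open Scope classical_set_scope.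
Local Open Scope ring_scope.

(** For Bernoulli laws probability generating functions are affine. Evaluate
them at s = 1 - y, with y a column of [0, 1]^d: an offspring vector of type i
in generation n contributes the factor 1 - (B_n y)_i, and an immigration
vector the factor 1 - m_n y. Hence passing from X_(n-1) to X_n replaces y by
B_n y and multiplies by 1 - m_n y, and ([gwi_pgf])

  E prod_i (1 - y_i)^(X_n,i) = prod_(1 <= j <= n) (1 - m_j B_[j,n] y).

So X_n is distributed like a sum of independent Bernoulli vectors, the j-th of
which records what is left at time n of the immigration of time j, and the
theorem is a law of small numbers. Its terms a_(j,n) = m_j B_[j,n] y lie in
[0, 1], tend to 0 for each j and are at most the total mass of m_j, which tends
to 0; thus the product has the same limit as exp (- sum_j a_(j,n))
([cvg_prod_expR]), and all that remains on the analytic side is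
sum_j m_j B_[j,n] --> lambda ([cvg_mean_sum]).

With mu_j = m_j (I - B_j)^-1 one has m_j B_[j,n] = mu_j A_(j,n), and the
matrices A_(j,n) = B_[j,n] - B_[j-1,n] telescope: their sum over p < j <= n is
I - B_[p,n] --> I. As mu_j --> lambda, the claim is a Toeplitz averaging
([toeplitz_cvg0]); it requires the sums of the absolute values of the entries
of A_(j,n) to be bounded ([bounded_A_sums]). If the norm of I - B_j is at most
D (1 - |B_j|), they are dominated by a telescoping sum of numbers; if the
entries are nonnegative, they are the telescoping sum itself; if the B_n are
diagonal in a common orthonormal basis, the eigenvalues are eventually in
[0, 1] and the telescoping takes place in each eigendirection.

On the probabilistic side the same approximation is used twice
([indicators_of_monomials]): every point indicator of Z_+^d is obtained from
the monomials s^k by linear combinations and uniform limits. It turns the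
convergence of generating functions into convergence of point masses, whence
the convergence of all bounded means, as the limit is a probability
([cvg_mean_bounded]). It also shows that X_n is independent of the
later offspring and immigration as soon as this is known for monomials of X_n
([Rintegral_indicator_factor]), which is what the induction on n provides. *)

(** * Toeplitz averages and products of small factors *)

Lemma cvg_sumr (R : realType) (I : Type) (r : seq I) (Q : pred I)
    (f : I -> nat -> R) (l : I -> R) :
  (forall i, Q i -> f i n @[n --> \oo] --> l i) ->
  \sum_(i <- r | Q i) f i n @[n --> \oo] --> \sum_(i <- r | Q i) l i.
Proof. by apply: cvg_big; exact: add_continuous. Qed.

(** The first terms of the sum are finitely many sequences tending to 0; in the
remaining ones [u] is uniformly small and the weights have bounded mass. *)
Lemma toeplitz_cvg0 (R : realType) (p : nat) (a : nat -> nat -> R)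
    (u : nat -> R) (C : R) :
  (\forall n \near \oo, \sum_(p <= j < n.+1) `|a j n| <= C) ->
  (forall j, (p <= j)%N -> a j n @[n --> \oo] --> 0) ->
  u n @[n --> \oo] --> 0 ->
  \sum_(p <= j < n.+1) u j * a j n @[n --> \oo] --> 0.
Proof.
move=> aC a0 u0; apply/cvgr0Pnorm_le => e e0.
pose D := `|C| + 1.
have D0 : 0 < D by rewrite ltr_wpDl.
have de0 : 0 < e / 2 / D by rewrite !divr_gt0.
have [J _ uJ] : \forall j \near \oo, `|u j| <= e / 2 / D.
  by move/cvgr0Pnorm_le : u0; exact.
pose K := maxn p J.
have head0 : \sum_(p <= j < K) u j * a j n @[n --> \oo] --> 0.
  rewrite [X in _ --> X](_ : 0 = \sum_(p <= j < K | (p <= j)%N) 0); last by rewrite big1.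
  have E n : \sum_(p <= j < K) u j * a j n =
      \sum_(p <= j < K | (p <= j)%N) u j * a j n.
    by rewrite big_nat_cond [RHS]big_nat_cond; apply: eq_bigl => j; case: (p <= j)%N.
  rewrite (funext E).
  apply: cvg_sumr => j pj.
  by rewrite -(mulr0 (u j)); apply: cvgMr; exact: a0.
have : \forall n \near \oo, `|\sum_(p <= j < K) u j * a j n| <= e / 2.
  by move/cvgr0Pnorm_le : head0; apply; rewrite divr_gt0.
move=> head; near=> n.
have Kn : (K <= n.+1)%N by near: n; exists K => // i /= /leqW.
rewrite (big_cat_nat (n := K)) ?leq_maxl//=.
rewrite (le_trans (ler_normD _ _))// (splitr e) lerD//; first by near: n.
rewrite (le_trans (ler_norm_sum _ _ _))//.
apply: (@le_trans _ _ (\sum_(K <= j < n.+1) e / 2 / D * `|a j n|)).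
  rewrite ler_sum_nat// => j /andP[Kj _]; rewrite normrM ler_wpM2r//.
  by apply: uJ; rewrite /= (leq_trans _ Kj)// leq_maxr.
rewrite -mulr_sumr -[leRHS](mulfVK (lt0r_neq0 D0)) ler_wpM2l//; first exact: ltW.
apply: (@le_trans _ _ C); last by rewrite /D (le_trans (ler_norm _))// lerDl.
have : \sum_(p <= j < n.+1) `|a j n| <= C by near: n.
rewrite (big_cat_nat (n := K)) ?leq_maxl//=; apply: le_trans.
by rewrite lerDr sumr_ge0.
Unshelve. all: by end_near. Qed.

Lemma expRN_le_quadratic (R : realType) (x : R) :
  0 <= x -> expR (- x) <= 1 - x + x ^+ 2.
Proof.
move=> x0; rewrite expRN.
have h := expR_ge1Dx x.
have x1 : 0 < 1 + x by rewrite ltr_pwDl.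
apply: (@le_trans _ _ (1 + x)^-1).
  by rewrite lef_pV2 ?posrE ?expR_gt0.
rewrite -[leLHS]mul1r ler_pdivrMr//.
have : 0 <= x ^+ 3 by rewrite exprn_ge0.
by rewrite !exprS expr0; nra.
Qed.

(** Replace the factors one at a time: each exchange costs the difference of two
factors, as the other factors have modulus at most 1. *)
Lemma ler_norm_prodB (R : realType) (r : seq nat) (f g : nat -> R) :
  (forall j, 0 <= f j <= 1) -> (forall j, 0 <= g j <= 1) ->
  `|\prod_(j <- r) f j - \prod_(j <- r) g j| <= \sum_(j <- r) `|f j - g j|.
Proof.
move=> f01 g01; elim: r => [|j r IH]; first by rewrite !big_nil subrr normr0.
rewrite !big_cons.
set F := \prod_(j <- r) f j in IH *; set G := \prod_(j <- r) g j in IH *.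
have F1 : 0 <= F <= 1.
  rewrite prodr_ge0/=; last by move=> i _; case/andP: (f01 i).
  by apply: prodr_ile1 => i _; exact: f01.
have -> : f j * F - g j * G = (f j - g j) * F + g j * (F - G).
  by rewrite mulrBl mulrBr subrKA.
rewrite (le_trans (ler_normD _ _))// !normrM lerD//.
  by rewrite ler_piMr// ger0_norm; case/andP: F1.
rewrite (le_trans _ IH)// ler_piMl// ger0_norm; by case/andP: (g01 j).
Qed.

(** A law of small numbers: exchanging [1 - a] for [expR (- a)] costs at most
[a ^+ 2], and the sum of the squares is at most the sum of [u j * a j n], a
Toeplitz average of a null sequence. *)
Lemma cvg_prod_expR (R : realType) (a : nat -> nat -> R) (u : nat -> R) (s : R) :
  (forall j n, (0 < j <= n)%N -> 0 <= a j n <= 1) ->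
  (forall j n, (0 < j <= n)%N -> a j n <= u j) ->
  u n @[n --> \oo] --> 0 ->
  (forall j, (0 < j)%N -> a j n @[n --> \oo] --> 0) ->
  \sum_(1 <= j < n.+1) a j n @[n --> \oo] --> s ->
  \prod_(1 <= j < n.+1) (1 - a j n) @[n --> \oo] --> expR (- s).
Proof.
move=> a01 au u0 a0 sa.
(* extended by 0, so that the bounds hold for every j *)
pose b n j := if (0 < j <= n)%N then a j n else 0.
have b01 n j : 0 <= b n j <= 1.
  by rewrite /b; case: ifPn => [/(a01 j n)//|_]; rewrite lexx ler01.
have bE n j : (1 <= j < n.+1)%N -> a j n = b n j.
  by rewrite /b ltnS => ->.
have key : \prod_(1 <= j < n.+1) (1 - a j n) -
    expR (- \sum_(1 <= j < n.+1) a j n) @[n --> \oo] --> 0.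
  apply: norm_cvg0.
  apply: (@squeeze_cvgr _ _ _ _ (fun=> 0)
    (fun n => \sum_(1 <= j < n.+1) u j * a j n)); last 2 first.
  - exact: cvg_cst.
  - apply: (@toeplitz_cvg0 _ _ _ _ (s + 1)) => //.
    near=> n.
    rewrite (eq_big_nat _ _ (F2 := fun j => a j n)); last first.
      by move=> j jn; case/andP: (a01 j n jn) => ? _; rewrite ger0_norm.
    near: n; move/cvgrPdist_le : sa => /(_ 1 ltr01).
    by apply: filterS => n; rewrite ler_norml => /andP[]; lra.
  near=> n; rewrite normr_ge0/=.
  have -> : \prod_(1 <= j < n.+1) (1 - a j n) =
      \prod_(1 <= j < n.+1) (1 - b n j).
    by apply: eq_big_nat => j /bE ->.
  have -> : \sum_(1 <= j < n.+1) a j n = \sum_(1 <= j < n.+1) b n j.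
    by apply: eq_big_nat => j /bE.
  rewrite -sumrN expR_sum.
  apply: (le_trans (ler_norm_prodB _ _ _)).
  - by move=> j; move: (b01 n j) => /andP[? ?]; lra.
  - move=> j; rewrite expR_ge0 -expR0 ler_expR oppr_le0.
    by case/andP: (b01 n j).
  apply: ler_sum_nat => j jn; rewrite -(bE n j)//.
  move: (a01 j n jn) (au j n jn) => /andP[a0' a1'] ajn.
  rewrite distrC ger0_norm; last by rewrite subr_ge0 expR_ge1Dx.
  rewrite lerBlDl (le_trans (expRN_le_quadratic _))// lerD2l expr2.
  exact: ler_wpM2r.
rewrite -[expR (- s)]add0r.
rewrite (_ : (fun n => \prod_(1 <= j < n.+1) (1 - a j n)) = (fun n =>
   (\prod_(1 <= j < n.+1) (1 - a j n) - expR (- \sum_(1 <= j < n.+1) a j n)) +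
    expR (- \sum_(1 <= j < n.+1) a j n))); last first.
  by apply/funext => n; rewrite subrK.
apply: cvgD => //.
by apply: continuous_cvg; [exact: continuous_expR | exact: cvgN].
Unshelve. all: by end_near. Qed.

(** * Norms of row vectors *)

Section norm.
Context {R : realType} {d : nat} {N : 'rV[R]_d -> R} (N_norm : is_norm N).

Lemma is_norm0 : N 0 = 0.
Proof. by rewrite -(scale0r 0) norm_homogeneous// normr0 mul0r. Qed.

Lemma is_normN x : N (- x) = N x.
Proof. by rewrite -scaleN1r norm_homogeneous// normrN1 mul1r. Qed.

Lemma is_norm_ge0 x : 0 <= N x.
Proof.
have := norm_triangle N_norm x (- x).
by rewrite subrr is_norm0 is_normN -mulr2n pmulrn_lge0.
Qed.

Lemma is_norm_sum (I : Type) (r : seq I) (F : I -> 'rV[R]_d) :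
  N (\sum_(i <- r) F i) <= \sum_(i <- r) N (F i).
Proof.
elim: r => [|i r IH]; first by rewrite !big_nil is_norm0.
by rewrite !big_cons (le_trans (norm_triangle N_norm _ _))// lerD2l.
Qed.

Lemma entry_le_mx_norm m n (A : 'M[R]_(m, n)) i j : `|A i j| <= `|A|.
Proof.
rewrite [leRHS]/Num.Def.normr /= mx_normrE.
by apply/bigmax_geP; right => /=; exists (i, j).
Qed.

Lemma is_norm_mul_le (A : 'M[R]_d) x :
  N (x *m A) <= (\sum_(i < d) N (row i A)) * `|x|.
Proof.
rewrite mulmx_sum_row (le_trans (is_norm_sum _ _))// mulr_suml.
apply: ler_sum => i _; rewrite norm_homogeneous// mulrC.
by rewrite ler_wpM2l ?is_norm_ge0// entry_le_mx_norm.
Qed.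

Lemma is_norm_le_mx_norm : exists2 K, 0 < K & forall x, N x <= K * `|x|.
Proof.
exists (\sum_(i < d) N (row i 1%:M) + 1).
  by rewrite ltr_wpDl// sumr_ge0// => i _; exact: is_norm_ge0.
move=> x; rewrite -{1}(mulmx1 x) (le_trans (is_norm_mul_le _ _))//.
by rewrite ler_wpM2r// lerDl.
Qed.

(** This is continuity for the sup norm, which carries the topology of row vectors;
[N] is Lipschitz for it. *)
Lemma is_norm_continuous : continuous N.
Proof.
have [K K0 NK] := is_norm_le_mx_norm.
move=> x; have FF : Filter (nbhs x) by exact: nbhs_filter.
apply/cvgrPdist_le => e e0.
have : \forall y \near x, `|x - y| <= e / K.
  apply/nbhs_normP; exists (e / K) => /=; first by rewrite divr_gt0.
  by move=> y /= /ltW.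
apply: filterS => y xy.
have h a b : N a - N b <= N (a - b).
  by rewrite lerBlDr -{1}(subrK b a) norm_triangle.
apply: (@le_trans _ _ (N (x - y))).
  rewrite ler_norml h andbT lerNl opprB.
  by rewrite -(is_normN (x - y)) opprB h.
by rewrite (le_trans (NK _))// mulrC -ler_pdivlMr.
Qed.

(** The other half of the equivalence of norms: by compactness [N] attains a
positive minimum on the unit sphere of the sup norm. The case of an empty sphere
is that of dimension 0. *)
Lemma mx_norm_le_is_norm : exists2 K, 0 < K & forall x, `|x| <= K * N x.
Proof.
pose S := [set x : 'rV[R]_d | `|x| = 1].
have [S0|S0] := pselect (S !=set0); last first.
  exists 1 => // x; have [->|x0] := eqVneq x 0.
    by rewrite normr0 mul1r is_norm_ge0.
  case: S0; exists (`|x|^-1 *: x).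
  by rewrite /S/= normrZ normfV normr_id mulVf// normr_eq0.
have cS : compact S.
  apply: bounded_closed_compact.
    by exists 1; split => // M M1 x /= ->; exact: ltW.
  rewrite (_ : S = (fun x => `|x|) @^-1` [set 1])//.
  by apply: closed_comp => [x _|]; [exact: norm_continuous|exact: closed_eq].
have [x0] := EVT_min_rV S0 cS (continuous_subspaceT is_norm_continuous).
move=> /set_mem; rewrite /S/= => x01 x0min.
have Nx0 : 0 < N x0.
  rewrite lt_def is_norm_ge0 andbT; apply/eqP => /(norm_definite N_norm) x00.
  by move: x01; rewrite x00 normr0 => /esym/eqP; rewrite oner_eq0.
exists (N x0)^-1 => [|x]; first by rewrite invr_gt0.
have [->|xn0] := eqVneq x 0.
  by rewrite normr0 is_norm0 mulr0.
have nx : 0 < `|x| by rewrite normr_gt0.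
rewrite mulrC ler_pdivlMr//.
have /x0min : `|x|^-1 *: x \in S.
  by apply/mem_set; rewrite /S/= normrZ normfV normr_id mulVf ?gt_eqF.
by rewrite norm_homogeneous// normfV normr_id mulrC ler_pdivlMr// mulrC.
Qed.

Lemma opnorm_has_sup (A : 'M[R]_d) :
  has_sup [set N (x *m A) | x in [set x | N x <= 1]].
Proof.
split; first by exists (N (0 *m A)), 0 => //=; rewrite is_norm0.
have [K K0 NK] := mx_norm_le_is_norm.
exists ((\sum_(i < d) N (row i A)) * K) => _ [x/= Nx1 <-].
rewrite (le_trans (is_norm_mul_le _ _))// ler_wpM2l//.
  by rewrite sumr_ge0// => i _; exact: is_norm_ge0.
by rewrite (le_trans (NK _))// ler_piMr// ltW.
Qed.

Lemma is_norm_mulmx_le_opnorm (A : 'M[R]_d) x :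
  N x <= 1 -> N (x *m A) <= opnorm N A.
Proof.
move=> x1; have /ubP := sup_upper_bound (opnorm_has_sup A).
by apply; exists x.
Qed.

Lemma opnorm_ge0 (A : 'M[R]_d) : 0 <= opnorm N A.
Proof.
by have := @is_norm_mulmx_le_opnorm A 0; rewrite mul0mx is_norm0 => /(_ ler01).
Qed.

(** This is the defining bound of the operator norm, usable because the supremum
in [opnorm] is that of a bounded set; that in turn rests on the equivalence of
norms. *)
Lemma is_norm_mulmx x (A : 'M[R]_d) : N (x *m A) <= opnorm N A * N x.
Proof.
have [->|x0] := eqVneq x 0; first by rewrite mul0mx is_norm0 mulr0.
have Nx : 0 < N x.
  rewrite lt_def is_norm_ge0 andbT; apply: contra x0 => /eqP.
  by move/(norm_definite N_norm) => ->.
have iN : 0 <= (N x)^-1 by rewrite invr_ge0 ltW.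
rewrite -ler_pdivrMr// mulrC -[(N x)^-1]ger0_norm//.
rewrite -norm_homogeneous// scalemxAl.
apply: is_norm_mulmx_le_opnorm.
by rewrite norm_homogeneous// ger0_norm// mulVf ?gt_eqF.
Qed.

Lemma entry_le_opnorm : exists2 K, 0 < K &
  forall (A : 'M[R]_d) i k, `|A i k| <= K * opnorm N A.
Proof.
have [K K0 NK] := mx_norm_le_is_norm.
have [L L0 NL] := is_norm_le_mx_norm.
pose D := \sum_(i < d) N (delta_mx 0 i) + 1.
have ND i : N (delta_mx 0 i) <= D.
  rewrite /D (bigD1 i)//= -addrA lerDl addr_ge0// sumr_ge0// => j _.
  exact: is_norm_ge0.
have D0 : 0 < D.
  by rewrite ltr_wpDl// sumr_ge0// => j _; exact: is_norm_ge0.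
exists (K * D) => [|A i k]; first by rewrite mulr_gt0.
rewrite (_ : A i k = row i A 0 k); last by rewrite mxE.
rewrite (le_trans (entry_le_mx_norm _ _ _))// (le_trans (NK _))//.
rewrite -mulrA ler_wpM2l ?(ltW K0)// rowE (le_trans (is_norm_mulmx _ _))//.
by rewrite mulrC ler_wpM2r ?opnorm_ge0.
Qed.

(** A vector fixed by [A] would satisfy [N v <= opnorm N A * N v]. *)
Lemma unitmx_subr_opnorm (A : 'M[R]_d) :
  opnorm N A < 1 -> 1%:M - A \in unitmx.
Proof.
move=> A1; rewrite -row_free_unit -kermx_eq0; apply/rowV0P => v.
move/sub_kermxP; rewrite mulmxBr mulmx1 => /eqP; rewrite subr_eq0 => /eqP vA.
apply: (norm_definite N_norm); apply/eqP; rewrite eq_le is_norm_ge0 andbT.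
have := is_norm_mulmx v A; rewrite -vA -subr_ge0 -{2}(mul1r (N v)) -mulrBl.
by rewrite nmulr_rge0// subr_lt0.
Qed.

End norm.

(** * Telescoping tails of matrix products *)

(** The ring is arbitrary, and not commutative, because this telescoping is used
for the mean matrices, for their norms and for their eigenvalues. *)
Lemma telescope_prod_tails (Rg : pzRingType) (b : nat -> Rg) (p n : nat) :
  (p <= n)%N ->
  \sum_(p.+1 <= j < n.+1) (1 - b j) * \prod_(j.+1 <= k < n.+1) b k =
  1 - \prod_(p.+1 <= k < n.+1) b k.
Proof.
move=> pn; pose f j := \prod_(j <= k < n.+1) b k.
rewrite (eq_big_nat _ _ (F2 := fun j => f j.+1 - f j)); last first.
  by move=> j /andP[_ jn]; rewrite /f (big_ltn jn) mulrBl mul1r.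
by rewrite telescope_sumr// {1}/f big_geq.
Qed.

Section mean_prod_lemmas.
Context {R : realType} {d : nat} (B : nat -> 'M[R]_d).

Lemma mean_prod_nn n : mean_prod B n n = 1%:M.
Proof. by rewrite /mean_prod big_geq. Qed.

Lemma mean_prod_recr j n : (j <= n)%N ->
  mean_prod B j n.+1 = mean_prod B j n *m B n.+1.
Proof. by move=> jn; rewrite /mean_prod big_nat_recr. Qed.

Lemma sum_A_mx p n : (p <= n)%N ->
  \sum_(p.+1 <= j < n.+1) A_mx B j n = 1%:M - mean_prod B p n.
Proof. exact: (@telescope_prod_tails 'M[R]_d B). Qed.

End mean_prod_lemmas.

Section tails.
Context {R : realType} {d : nat} (B : nat -> 'M[R]_d).

(** The weights of the Toeplitz average. The lower end [p] can be taken beyond any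
prescribed [q], so that the same [p] also serves conditions that hold only
eventually. *)
Definition bounded_A_sums : Prop :=
  forall q, exists2 p, (q <= p)%N & forall i k, exists C,
    \forall n \near \oo, \sum_(p.+1 <= j < n.+1) `|A_mx B j n i k| <= C.

Lemma norm_mean_prod_le (N : 'rV[R]_d -> R) (N_norm : is_norm N) x j n :
  (j <= n)%N ->
  N (x *m mean_prod B j n) <= N x * \prod_(j.+1 <= k < n.+1) opnorm N (B k).
Proof.
elim: n => [|n IH] jn.
  move: jn; rewrite leqn0 => /eqP ->.
  by rewrite mean_prod_nn mulmx1 big_geq// mulr1.
move: jn; rewrite leq_eqVlt => /predU1P[->|jn].
  by rewrite mean_prod_nn mulmx1 big_geq// mulr1.
rewrite mean_prod_recr// mulmxA big_nat_recr//=.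
rewrite (le_trans (is_norm_mulmx N_norm _ _))// mulrA mulrC.
by rewrite ler_wpM2r ?opnorm_ge0// IH.
Qed.

(** With b_j the norm of B_j, the entries of A_(j,n) are at most a constant times
(1 - b_j) b_(j+1) ... b_n, and these numbers telescope to at most 1. *)
Lemma bounded_A_sums_opnorm (N : 'rV[R]_d -> R) (N_norm : is_norm N) (D : R) :
  (\forall n \near \oo, opnorm N (B n) < 1) ->
  (\forall n \near \oo,
     opnorm N (1%:M - B n) / (1 - opnorm N (B n)) <= D) ->
  bounded_A_sums.
Proof.
move=> [n0 _ B1] [n1 _ BD] q; exists (maxn q (maxn n0 n1)).
  exact: leq_maxl.
move=> i k; set p := maxn q _.
have [K K0 NK] := mx_norm_le_is_norm N_norm.
exists (K * N (delta_mx 0 i) * D).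
near=> n.
have pn : (p <= n)%N by near: n; exists p.
pose b j := opnorm N (B j).
have bp j : (p < j)%N -> 0 <= b j < 1.
  move=> pj; rewrite opnorm_ge0//=; apply: B1 => /=.
  by rewrite (leq_trans _ (ltnW pj))// /p leq_max leq_max leqnn orbT.
have bD j : (p < j)%N -> opnorm N (1%:M - B j) <= D * (1 - b j).
  move=> pj; rewrite -ler_pdivrMr; last first.
    by rewrite subr_gt0; case/andP: (bp _ pj).
  by apply: BD => /=; rewrite (leq_trans _ (ltnW pj))// /p !leq_max leqnn !orbT.
(* D bounds a quotient of nonnegative numbers *)
have D0 : 0 <= D.
  have /andP[_ bp1] := bp p.+1 (ltnSn _).
  have := le_trans (opnorm_ge0 N_norm _) (bD p.+1 (ltnSn _)).
  by rewrite pmulr_lge0// subr_gt0.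
apply: (@le_trans _ _ (\sum_(p.+1 <= j < n.+1)
   K * N (delta_mx 0 i) * D *
     ((1 - b j) * \prod_(j.+1 <= k < n.+1) b k))).
  apply: ler_sum_nat => j /andP[pj jn].
  rewrite (_ : A_mx B j n i k = row i (A_mx B j n) 0 k); last by rewrite [RHS]mxE.
  rewrite (le_trans (entry_le_mx_norm _ _ _))// (le_trans (NK _))//.
  rewrite -!mulrA ler_wpM2l ?(ltW K0)// rowE /A_mx mulmxA.
  rewrite (le_trans (norm_mean_prod_le N_norm _ _))//.
  have P0 : 0 <= \prod_(j.+1 <= k0 < n.+1) b k0.
    by apply: prodr_ge0 => l _; exact: opnorm_ge0.
  rewrite [leRHS]mulrA [leRHS]mulrA ler_wpM2r// -mulrA.
  rewrite (le_trans (is_norm_mulmx N_norm _ _))// mulrC.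
  by rewrite ler_wpM2l ?is_norm_ge0// bD.
rewrite -mulr_sumr telescope_prod_tails//.
rewrite ler_piMr ?mulr_ge0 ?is_norm_ge0 ?(ltW K0)//.
by rewrite gerBl prodr_ge0// => l _; exact: opnorm_ge0.
Unshelve. all: by end_near. Qed.

(** Without absolute values the sum telescopes, and it converges. *)
Lemma bounded_A_sums_nonneg :
  (forall j, (0 < j)%N -> forall i k, mean_prod B j n i k @[n --> \oo] --> 0) ->
  (\forall n \near \oo, forall j, (1 <= j <= n)%N ->
     forall i k, 0 <= A_mx B j n i k) ->
  bounded_A_sums.
Proof.
move=> I3 A0 q; exists q.+1 => // i k.
exists ((1%:M : 'M[R]_d) i k + 1).
near=> n.
have qn : (q.+1 <= n)%N by near: n; exists q.+1.
have An : forall j, (1 <= j <= n)%N -> forall i k, 0 <= A_mx B j n i k.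
  by near: n.
rewrite (eq_big_nat _ _ (F2 := fun j => A_mx B j n i k)); last first.
  move=> j /andP[qj jn]; rewrite ger0_norm// An//.
  by rewrite -(ltnS j) jn andbT (leq_trans _ qj).
rewrite -summxE sum_A_mx// !mxE lerD2l.
have : `|mean_prod B q.+1 n i k| <= 1.
  near: n; have /cvgr0Pnorm_le := I3 q.+1 (ltn0Sn _) i k.
  by apply.
by rewrite ler_norml => /andP[]; rewrite lerNl.
Unshelve. all: by end_near. Qed.

Lemma mean_prod_diag (U : 'M[R]_d) (rho : nat -> 'rV[R]_d) :
  U *m U^T = 1%:M ->
  (forall n, (0 < n)%N -> B n = U *m diag_mx (rho n) *m U^T) ->
  forall j n, (j <= n)%N -> mean_prod B j n =
    U *m diag_mx (\row_l \prod_(j.+1 <= k < n.+1) rho k 0 l) *m U^T.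
Proof.
move=> UU BU j; elim=> [|n IH] jn.
  move: jn; rewrite leqn0 => /eqP ->; rewrite mean_prod_nn.
  rewrite (_ : \row_l _ = const_mx 1); last first.
    by apply/rowP => l; rewrite !mxE big_geq.
  by rewrite diag_const_mx mulmx1.
move: jn; rewrite leq_eqVlt => /predU1P[->|jn].
  rewrite mean_prod_nn (_ : \row_l _ = const_mx 1); last first.
    by apply/rowP => l; rewrite !mxE big_geq.
  by rewrite diag_const_mx mulmx1.
rewrite mean_prod_recr// IH// BU// !mulmxA -(mulmxA _ U^T U) (mulmx1C UU) mulmx1.
congr (_ *m _); rewrite -!mulmxA; congr (_ *m _).
rewrite mulmx_diag; congr diag_mx; apply/rowP => l.
by rewrite !mxE [RHS]big_nat_recr.
Qed.

(** All B_n have the rows of the transpose of [U] as eigenvectors, so their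
eigenvalues are below 1 in modulus by the norm bound and close to 1 by
[B n --> 1]: they are eventually in [0, 1]. There the products telescoping in
each eigendirection have nonnegative terms of sum at most 1. *)
Lemma bounded_A_sums_diag (N : 'rV[R]_d -> R) (N_norm : is_norm N)
    (U : 'M[R]_d) (rho : nat -> 'rV[R]_d) :
  (forall i k, B n i k @[n --> \oo] --> (1%:M : 'M[R]_d) i k) ->
  (\forall n \near \oo, opnorm N (B n) < 1) ->
  U *m U^T = 1%:M ->
  (forall n, (0 < n)%N -> B n = U *m diag_mx (rho n) *m U^T) ->
  bounded_A_sums.
Proof.
move=> I1 B1 UU BU q.
have UTU := mulmx1C UU.
have rho1 l : rho n 0 l @[n --> \oo] --> (1 : R).
  have E n : (0 < n)%N ->
      rho n 0 l = \sum_(a < d) \sum_(b < d) U b l * B n b a * U a l.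
    move=> n0; have -> : rho n 0 l = diag_mx (rho n) l l.
      by rewrite mxE eqxx mulr1n.
    have -> : diag_mx (rho n) = U^T *m B n *m U.
      by rewrite BU// !mulmxA UTU mul1mx -mulmxA UTU mulmx1.
    rewrite mxE; apply: eq_bigr => a _; rewrite mxE mulr_suml.
    by apply: eq_bigr => b _; rewrite mxE.
  have E1 : 1 = \sum_(a < d) \sum_(b < d) U b l * (1%:M : 'M[R]_d) b a * U a l.
    transitivity ((U^T *m 1%:M *m U) l l).
      by rewrite mulmx1 UTU mxE eqxx.
    rewrite mxE; apply: eq_bigr => a _; rewrite mxE mulr_suml.
    by apply: eq_bigr => b _; rewrite mxE.
  rewrite [X in _ --> X]E1.
  apply: cvg_trans; last first.
    apply: cvg_sumr => a _; apply: cvg_sumr => b _.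
    by apply: cvgMl; apply: cvgMr; exact: I1.
  apply: near_eq_cvg; near=> n; rewrite E//.
  by near: n; exists 1%N.
have rhoB l : \forall n \near \oo, 0 <= rho n 0 l <= 1.
  near=> n; apply/andP; split.
    near: n; have /cvgrPdist_le/(_ 1 ltr01) := rho1 l.
    by apply: filterS => n; rewrite ler_norml => /andP[_]; lra.
  have n0 : (0 < n)%N by near: n; exists 1%N.
  have Bn : opnorm N (B n) < 1 by near: n.
  (* the rows of the transpose of U are eigenvectors *)
  have vB : row l U^T *m B n = rho n 0 l *: row l U^T.
    rewrite BU// !mulmxA -row_mul UTU row1 -rowE row_diag_mx -scalemxAl.
    by rewrite -rowE.
  have v0 : 0 < N (row l U^T).
    rewrite lt_def (is_norm_ge0 N_norm) andbT; apply/eqP.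
    move/(norm_definite N_norm) => v0.
    have : row l (U^T *m U) 0 l = 0 by rewrite row_mul v0 mul0mx mxE.
    by rewrite UTU !mxE eqxx => /eqP; rewrite oner_eq0.
  have := is_norm_mulmx N_norm (row l U^T) (B n).
  rewrite vB norm_homogeneous// ler_pM2r// => h.
  by rewrite (le_trans (ler_norm _))// (le_trans h)// ltW.
have : \forall n \near \oo, forall l, 0 <= rho n 0 l <= 1.
  exact: filter_forall.
move=> [n1 _ rho01]; exists (maxn q n1); first exact: leq_maxl.
set p := maxn q n1 => i k.
exists (\sum_(l < d) `|U i l| * `|U k l|).
near=> n.
have pn : (p <= n)%N by near: n; exists p.
pose c j l := (1 - rho j 0 l) * \prod_(j.+1 <= k < n.+1) rho k 0 l.
have rhop j l : (p <= j)%N -> 0 <= rho j 0 l <= 1.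
  by move=> pj; apply: rho01; rewrite /= (leq_trans _ pj)// leq_maxr.
have prod0 j l : (p <= j)%N -> 0 <= \prod_(j.+1 <= k < n.+1) rho k 0 l.
  move=> pj; rewrite big_nat_cond prodr_ge0// => a /andP[/andP[ja _] _].
  by case/andP: (rhop a l (leq_trans pj (ltnW ja))).
have cE j : (p < j < n.+1)%N -> A_mx B j n i k =
    \sum_(l < d) U i l * c j l * U k l.
  move=> /andP[pj jn].
  rewrite /A_mx (mean_prod_diag UU BU)// BU; last exact: leq_ltn_trans pj.
  rewrite -{1}UU -[X in (X - _) *m _](mulmx1 _).
  have -> : U *m U^T *m 1%:M = U *m diag_mx (const_mx 1) *m U^T.
    by rewrite diag_const_mx !mulmx1.
  rewrite -mulmxBl -mulmxBr !mulmxA -(mulmxA _ U^T U) UTU mulmx1.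
  rewrite -linearB/= -(mulmxA U) mulmx_diag mxE; apply: eq_bigr => l _.
  rewrite [_^T _ _]mxE; congr (_ * _).
  by rewrite mul_mx_diag !mxE.
apply: (@le_trans _ _ (\sum_(p.+1 <= j < n.+1)
   \sum_(l < d) (`|U i l| * `|U k l|) * c j l)).
  apply: ler_sum_nat => j jn; rewrite cE//.
  rewrite (le_trans (ler_norm_sum _ _ _))// ler_sum// => l _.
  rewrite normrM (normrM (U i l)) mulrAC (@ger0_norm _ (c j l))//.
  case/andP: jn => pj _; rewrite /c mulr_ge0 ?prod0 ?(ltnW pj)//.
  by rewrite subr_ge0; case/andP: (rhop j l (ltnW pj)).
rewrite exchange_big/=; apply: ler_sum => l _.
rewrite -mulr_sumr /c telescope_prod_tails//.
by rewrite ler_piMr ?mulr_ge0// gerBl prod0.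
Unshelve. all: by end_near. Qed.

(** Beyond [p] one has [m j = mu j *m (1%:M - B j)]. Split [mu j] into [lam], for
which the sum telescopes to [lam *m (1%:M - mean_prod B p n)], and
[mu j - lam], a null sequence averaged against bounded weights. The terms up to
[p] vanish one by one. *)
Lemma cvg_mean_sum (m : nat -> 'rV[R]_d) (lam : 'rV[R]_d) :
  (forall j, (0 < j)%N -> forall i k, mean_prod B j n i k @[n --> \oo] --> 0) ->
  (\forall n \near \oo, 1%:M - B n \in unitmx) ->
  (forall k, (m n *m invmx (1%:M - B n)) 0 k @[n --> \oo] --> lam 0 k) ->
  bounded_A_sums ->
  forall k, \sum_(1 <= j < n.+1) (m j *m mean_prod B j n) 0 k @[n --> \oo]
    --> lam 0 k.
Proof.
move=> I3 [n0 _ unit] M bA k.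
have [p n0p {}bA] := bA n0.+1.
pose mu j := m j *m invmx (1%:M - B j).
have muK j : (p < j)%N -> m j = mu j *m (1%:M - B j).
  by move=> pj; rewrite mulmxKV// unit//= ltnW// (leq_trans _ (ltnW pj)).
have p0 : (0 < p)%N by exact: leq_trans n0p.
have A0 j i : (p < j)%N -> A_mx B j n i k @[n --> \oo] --> 0.
  move=> pj; rewrite [X in _ --> X](_ : 0 =
      \sum_(l < d) (1%:M - B j) i l * 0); last by rewrite big1// => *; rewrite mulr0.
  rewrite (_ : (fun n => _) = (fun n => \sum_(l < d)
      (1%:M - B j) i l * mean_prod B j n l k)); last first.
    by apply/funext => n; rewrite mxE.
  apply: cvg_sumr => l _; apply: cvgMr; apply: I3.
  exact: leq_ltn_trans pj.
have lim1 i : \sum_(p.+1 <= j < n.+1) (mu j 0 i - lam 0 i) * A_mx B j n i k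
    @[n --> \oo] --> 0.
  have [C bC] := bA i k.
  apply: (toeplitz_cvg0 bC) => [j pj|]; first exact: A0.
  rewrite -(subrr (lam 0 i)); apply: cvgB; [exact: M|exact: cvg_cst].
have lim2 i : lam 0 i * (1%:M - mean_prod B p n) i k @[n --> \oo] -->
    lam 0 i * (1%:M : 'M[R]_d) i k.
  apply: cvgMr; rewrite -[X in _ --> X]subr0.
  rewrite (_ : (fun n => _) = (fun n => (1%:M : 'M[R]_d) i k -
      mean_prod B p n i k)); last by apply/funext => n; rewrite !mxE.
  by apply: cvgB; [exact: cvg_cst|exact: I3].
have lim3 : \sum_(1 <= j < p.+1) (m j *m mean_prod B j n) 0 k
    @[n --> \oo] --> 0.
  rewrite [X in _ --> X](_ : 0 = \sum_(1 <= j < p.+1 | (0 < j)%N)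
      \sum_(l < d) m j 0 l * 0); last first.
    by rewrite big1// => j _; rewrite big1// => l _; rewrite mulr0.
  rewrite (_ : (fun n => _) = (fun n => \sum_(1 <= j < p.+1 | (0 < j)%N)
      \sum_(l < d) m j 0 l * mean_prod B j n l k)); last first.
    apply/funext => n; rewrite big_nat_cond [RHS]big_nat_cond.
    apply: eq_big => [j|j _]; last by rewrite mxE.
    by case: (0 < j)%N.
  apply: cvg_sumr => j j0; apply: cvg_sumr => l _; apply: cvgMr.
  exact: I3.
have lim4 : \sum_(i < d)
    (\sum_(p.+1 <= j < n.+1) (mu j 0 i - lam 0 i) * A_mx B j n i k +
     lam 0 i * (1%:M - mean_prod B p n) i k) @[n --> \oo] --> lam 0 k.
  rewrite [X in _ --> X](_ : _ =
      \sum_(i < d) (0 + lam 0 i * (1%:M : 'M[R]_d) i k)); last first.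
    rewrite -[lam in LHS]mulmx1 [LHS]mxE; apply: eq_bigr => i _.
    by rewrite add0r.
  by apply: cvg_sumr => i _; exact: cvgD (lim1 i) (lim2 i).
rewrite -[lam 0 k]add0r.
have E n : (p <= n)%N -> \sum_(1 <= j < n.+1) (m j *m mean_prod B j n) 0 k =
    \sum_(1 <= j < p.+1) (m j *m mean_prod B j n) 0 k + \sum_(i < d)
    (\sum_(p.+1 <= j < n.+1) (mu j 0 i - lam 0 i) * A_mx B j n i k +
     lam 0 i * (1%:M - mean_prod B p n) i k).
  move=> pn; rewrite (big_cat_nat (n := p.+1))//=; congr (_ + _).
  under [RHS]eq_bigr => i _.
    rewrite -sum_A_mx// summxE mulr_sumr -big_split/=.
    under eq_bigr do rewrite -mulrDl subrK.
    over.
  rewrite exchange_big/=; apply: eq_big_nat => j /andP[pj _].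
  by rewrite muK// -mulmxA mxE.
apply: (cvg_trans _ (cvgD lim3 lim4)); apply: near_eq_cvg; near=> n.
by apply/esym/E; near: n; exists p.
Unshelve. all: by end_near. Qed.

End tails.

(** * Monomials and point indicators *)

Section monomials.
Context {R : realType} {d : nat}.
Implicit Types (y : 'cV[R]_d) (k : 'rV[nat]_d).

(** The monomial [s ^ k] in the variables [s = 1 - y]; in terms of [y] the mean
matrices act linearly. *)
Definition mono y k : R := \prod_(i < d) (1 - y i 0) ^+ k 0 i.

Lemma mono0 y : mono y 0 = 1.
Proof. by rewrite /mono big1// => i _; rewrite mxE expr0. Qed.

Lemma monoD y k l : mono y (k + l) = mono y k * mono y l.
Proof.
by rewrite /mono -big_split/=; apply: eq_bigr => i _; rewrite mxE exprD.
Qed.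

Lemma mono_sum y (I : Type) (r : seq I) (F : I -> 'rV[nat]_d) :
  mono y (\sum_(i <- r) F i) = \prod_(i <- r) mono y (F i).
Proof.
by elim: r => [|i r IH]; rewrite ?big_nil ?mono0// !big_cons monoD IH.
Qed.

Lemma mono_delta y i : mono y (delta_mx 0 i) = 1 - y i 0.
Proof.
rewrite /mono (bigD1 i)//= mxE !eqxx expr1 big1 ?mulr1// => j ji.
by rewrite mxE eqxx (negbTE ji) expr0.
Qed.

Lemma mono_itv y k : (forall i, 0 <= y i 0 <= 1) -> 0 <= mono y k <= 1.
Proof.
move=> y01; have y01' i : 0 <= 1 - y i 0 <= 1.
  by have /andP[? ?] := y01 i; rewrite subr_ge0 gerBl; apply/andP.
rewrite prodr_ge0/=; last by move=> i _; rewrite exprn_ge0//; case/andP: (y01' i).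
apply: prodr_ile1 => i _; have /andP[? ?] := y01' i.
by rewrite exprn_ge0// exprn_ile1.
Qed.

(** For [s <= 1] the powers below [r] are removed exactly, the [r]-th one becomes 1,
and what is left is at most [s ^ (x - r) <= s]. *)
Lemma indicator_approx (s : R) (r x : nat) : 0 < s <= 1 ->
  `|(x == r)%:R - (s ^- r * s ^+ x + \sum_(l < r) (- (s ^- r * s ^+ l)) * (x == l)%:R)|
    <= s.
Proof.
move=> /andP[s0 s1].
have sr : s ^+ r != 0 by rewrite expf_neq0// gt_eqF.
have [xr|rx] := ltnP x r.
  rewrite (bigD1 (Ordinal xr))//= eqxx mulr1 big1 ?addr0; last first.
    move=> l lx; case: eqP => [xl|]; last by rewrite mulr0.
    by case/eqP: lx; apply: val_inj.
  by rewrite subrr (ltn_eqF xr) subr0 normr0 ltW.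
rewrite big1 ?addr0; last first.
  by move=> l _; rewrite gtn_eqF ?mulr0// (leq_trans (ltn_ord l)).
rewrite mulrC -expfB_cond; last by rewrite gt_eqF.
move: rx; rewrite leq_eqVlt => /predU1P[->|rx].
  by rewrite eqxx subnn expr0 subrr normr0 ltW.
rewrite gtn_eqF// sub0r normrN ger0_norm ?exprn_ge0 ?(ltW s0)//.
rewrite -[leRHS]expr1; apply: ler_wiXn2l => //; first exact: ltW.
by rewrite subn_gt0.
Qed.

(** One coordinate at a time, powers are traded for indicators: the indicator of
[r] is approximated by [s ^- r] times the power [s ^+ x] minus the indicators of
the smaller values, which are available by induction on [r]. Dividing by
[s ^+ r] is why the monomials are taken at [y < 1]. *)
Lemma indicators_of_monomials (L : ('rV[nat]_d -> R) -> Prop) :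
  (forall a f g, L f -> L g -> L (fun k => a * f k + g k)) ->
  (forall f, (forall e, 0 < e -> exists2 g, L g & forall k, `|f k - g k| <= e) ->
    L f) ->
  (forall y, (forall i, 0 <= y i 0 < 1) -> L (mono y)) ->
  forall k0, L (fun k => (k == k0)%:R).
Proof.
move=> Llin Lclosed Lmono.
have Lext f g : L f -> f =1 g -> L g by move=> + /funext <-.
have Lsum r (a : nat -> R) (G : nat -> 'rV[nat]_d -> R) f :
    L f -> (forall l, (l < r)%N -> L (G l)) ->
    L (fun k => f k + \sum_(l < r) a l * G l k).
  elim: r => [|r IH] Lf LG.
    by apply: (Lext _ _ Lf) => k; rewrite big_ord0 addr0.
  have Lr := IH Lf (fun l lr => LG l (ltnW lr)).
  apply: (Lext _ _ (Llin (a r) _ _ (LG r (ltnSn r)) Lr)) => k.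
  by rewrite big_ord_recr/= addrCA; congr (_ + _); rewrite addrC.
have Lscale a f : L f -> L (fun k => a * f k).
  move=> Lf; apply: (Lext _ _ (Llin a _ _ Lf (Llin (-1) _ _ Lf Lf))) => k.
  by rewrite mulN1r addNr addr0.
(* n counts the coordinates already turned into indicators *)
have ok n : (n <= d)%N -> forall phi : 'I_d -> nat -> R,
    (forall i : 'I_d, (i < n)%N -> exists r, phi i = fun x => (x == r)%:R) ->
    (forall i : 'I_d, (n <= i)%N ->
       exists2 s, 0 < s <= 1 & phi i = fun x => s ^+ x) ->
    L (fun k => \prod_(i < d) phi i (k 0 i)).
  elim: n => [|n IH] nd phi ind pow.
    have /choice[s sP] : forall i, exists s, 0 < s <= 1 /\ phi i = fun x => s ^+ x.
      by move=> i; have [//|s s01 ->] := pow i; exists s.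
    have y01 i : 0 <= (\col_i (1 - s i) : 'cV_d) i 0 < 1.
      by rewrite mxE; case: (sP i) => /andP[? ?] _; apply/andP; split; lra.
    apply: (Lext _ _ (Lmono _ y01)) => k; apply: eq_bigr => i _.
    by case: (sP i) => _ ->; rewrite mxE subKr.
  pose i0 : 'I_d := Ordinal nd.
  pose upd (g : nat -> R) i := if i == i0 then g else phi i.
  have updE g k : \prod_(i < d) upd g i (k 0 i) =
      g (k 0 i0) * \prod_(i < d | i != i0) phi i (k 0 i).
    rewrite (bigD1 i0)//= /upd eqxx; congr (_ * _).
    by apply: eq_bigr => i /negbTE ->.
  have phi01 i x : 0 <= phi i x <= 1.
    have [/ind[r ->]|/pow[s /andP[s0 s1] ->]] := ltnP i n.+1.
      by case: eqP; rewrite ?lexx ?ler01.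
    by rewrite exprn_ge0 ?exprn_ile1 ?(ltW s0).
  have upd_pow s : 0 < s <= 1 ->
      L (fun k => \prod_(i < d) upd (fun x => s ^+ x) i (k 0 i)).
    move=> s01; apply: IH; first exact: ltnW.
      move=> i i_n; rewrite /upd; case: eqP => [ii0|_]; last exact/ind/ltnW.
      by move: i_n; rewrite ii0 ltnn.
    move=> i ni; rewrite /upd; case: eqP => [_|ii0]; first by exists s.
    apply: pow; rewrite ltn_neqAle ni andbT; apply/eqP => nE.
    by apply: ii0; apply: val_inj.
  have upd_ind r :
      L (fun k => \prod_(i < d) upd (fun x => (x == r)%:R) i (k 0 i)).
    elim/ltn_ind: r => r IHr; apply: Lclosed => e e0.
    (* s is both the base of the powers and the error *)
    pose s := Num.min e 1.
    have s01 : 0 < s <= 1 by rewrite lt_min e0 ltr01 ge_min lexx orbT.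
    exists (fun k => s ^- r * \prod_(i < d) upd (fun x => s ^+ x) i (k 0 i) +
      \sum_(l < r) (- (s ^- r * s ^+ l)) *
        \prod_(i < d) upd (fun x => (x == l)%:R) i (k 0 i)).
      apply: (Lsum r (fun l => - (s ^- r * s ^+ l)) (fun l k =>
        \prod_(i < d) upd (fun x => (x == l)%:R) i (k 0 i))) => //.
      exact/Lscale/upd_pow.
    move=> k; under [X in _ - (_ + X)]eq_bigr do rewrite updE mulrA.
    rewrite -mulr_suml !updE mulrA -mulrDl -mulrBl normrM.
    apply: (@le_trans _ _ s); last by rewrite ge_min lexx.
    rewrite -[leRHS]mulr1 ler_pM// ?indicator_approx//.
    rewrite ger0_norm; first by apply: prodr_ile1 => i _; exact: phi01.
    by apply: prodr_ge0 => i _; case/andP: (phi01 i (k 0 i)).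
  have [r rE] := ind i0 (ltnSn n).
  apply: (Lext _ _ (upd_ind r)) => k; apply: eq_bigr => i _.
  by rewrite /upd; case: eqP => // ->; rewrite rE.
move=> k0.
apply: (Lext _ _ (ok d (leqnn d) (fun i x => (x == k0 0 i)%:R) _ _)).
- by move=> i _; exists (k0 0 i).
- by move=> i; rewrite leqNgt ltn_ord.
- move=> k /=; case: eqP => [->|kk0]; first by rewrite big1// => i _; rewrite eqxx.
  have /existsP[i ki] : [exists i, k 0 i != k0 0 i].
    apply: contraT; rewrite negb_exists => /forallP kk; case: kk0.
    by apply/rowP => i; apply/eqP/negPn.
  by rewrite (bigD1 i)//= (negbTE ki) mul0r.
Qed.

End monomials.

(** * Integrals over the fibers of a discrete variable *)

Section fibers.
Context {dsp1 dsp2 : measure_display} {T1 : measurableType dsp1}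
  {T2 : measurableType dsp2} {R : realType} (d : nat)
  (P1 : {measure set T1 -> \bar R}) (P2 : {measure set T2 -> \bar R}).

Lemma integral_fibers dsp (T : measurableType dsp)
    (mu : {measure set T -> \bar R}) (Y : T -> 'rV[nat]_d) (D : set T)
    (f : T -> \bar R) :
  measurable_fun setT Y -> measurable D -> measurable_fun setT f ->
  (forall w, 0 <= f w)%E ->
  (\int[mu]_(w in D) f w = \sum_(n <oo)
    \int[mu]_(w in D `&` Y @^-1` [set k | pickle k = n]) f w)%E.
Proof.
move=> mY mD mf f0.
pose F n := D `&` Y @^-1` [set k | pickle k = n].
have UF : D = \bigcup_n F n.
  by apply/seteqP; split=> [w Dw|w [n _ []]//]; exists (pickle (Y w)).
rewrite [in LHS]UF ge0_integral_bigcup//.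
- move=> n; apply: measurableI => //.
  by rewrite -[X in measurable X]setTI; exact: mY.
- exact: measurable_funTS.
- by move=> i j _ _ [w [[_ /= <-] [_ /= <-]]].
Qed.

(** As the variables take countably many values, integrals may be compared fiber by
fiber. Two spaces are allowed, so that the lemma also compares two laws. *)
Lemma eq_integral_fibers (Y1 : T1 -> 'rV[nat]_d) (Y2 : T2 -> 'rV[nat]_d)
    (D1 : set T1) (D2 : set T2) (f : T1 -> \bar R) (g : T2 -> \bar R) :
  measurable_fun setT Y1 -> measurable_fun setT Y2 ->
  measurable D1 -> measurable D2 ->
  measurable_fun setT f -> measurable_fun setT g ->
  (forall w, 0 <= f w)%E -> (forall w, 0 <= g w)%E ->
  (forall k, \int[P1]_(w in D1 `&` Y1 @^-1` [set k]) f w =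
             \int[P2]_(w in D2 `&` Y2 @^-1` [set k]) g w)%E ->
  (\int[P1]_(w in D1) f w = \int[P2]_(w in D2) g w)%E.
Proof.
move=> mY1 mY2 mD1 mD2 mf mg f0 g0 fg.
rewrite (integral_fibers _ mY1)// (integral_fibers _ mY2)//.
apply: eq_eseriesr => n _.
case Ek : (@pickle_inv 'rV[nat]_d n) => [k|].
  have -> : [set l : 'rV[nat]_d | pickle l = n] = [set k].
    apply/seteqP; split=> l /=.
      by move=> ln; move: Ek; rewrite -ln pickleK_inv => -[].
    by move=> ->; have := @pickle_invK 'rV[nat]_d n; rewrite Ek.
  exact: fg.
have -> : [set l : 'rV[nat]_d | pickle l = n] = set0.
  by apply/seteqP; split=> l //= ln; move: Ek; rewrite -ln pickleK_inv.
by rewrite !preimage_set0 !setI0 !integral_set0.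
Qed.

End fibers.

Section expectations.
Context {dsp : measure_display} {T : measurableType dsp} {R : realType}
  (P : probability T R).

Lemma bounded_integrable (f : T -> R) (M : R) :
  measurable_fun setT f -> (forall w, `|f w| <= M) ->
  P.-integrable setT (EFin \o f).
Proof.
move=> mf fM; apply: measurable_bounded_integrable => //.
  by rewrite -ge0_fin_numE//; exact: fin_num_measure.
exists M; split; first exact: num_real.
by move=> x Mx w _ /=; exact: le_trans (ltW Mx).
Qed.


Lemma measurable_discrete_comp d d' (E : measurableType d')
    (Y : {RV P >-> 'rV[nat]_d}) (phi : 'rV[nat]_d -> E) :
  measurable_fun setT (fun w => phi (Y w)).
Proof. by apply: (@measurableT_comp _ _ _ _ _ _ phi). Qed.

Lemma measurable_fiber d (Y : {RV P >-> 'rV[nat]_d}) (A : set 'rV[nat]_d) :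
  measurable (Y @^-1` A).
Proof. by rewrite -[X in measurable X]setTI; exact: measurable_funPT. Qed.

End expectations.

(** * Finite families of independent variables *)

Section independence.
Context {dsp : measure_display} {T : measurableType dsp} {R : realType}
  (P : probability T R) (I : choiceType) (D : set I) (d : nat)
  (Y : I -> {RV P >-> 'rV[nat]_d}).
Hypothesis Y_indep : mutually_independent D Y.

(** The independence hypothesis is about finite sets of indices; a sequence without
repetition is the form in which products are handled below. *)
Lemma indep_seq (J : seq I) (A : I -> set 'rV[nat]_d) :
  uniq J -> (forall t, t \in J -> D t) ->
  P (\bigcap_(t in [set` J]) Y t @^-1` A t) = (\prod_(t <- J) P (Y t @^-1` A t))%E.
Proof.
move=> uJ JD.
have := @Y_indep (seq_fset tt J) A _ (fun _ => Logic.I).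
have -> : [set` seq_fset tt J] = [set` J].
  by apply/seteqP; split=> t; rewrite /mkset seq_fsetE.
move=> ->; last by move=> t /=; exact: JD.
by apply/perm_big/(uniq_perm (fset_uniq _) uJ) => t; rewrite seq_fsetE.
Qed.

Variable psi : I -> 'rV[nat]_d -> R.
Hypothesis psi01 : forall t k, 0 <= psi t k <= 1.

Lemma measurable_prod_psi (J : seq I) :
  measurable_fun setT (fun w => \prod_(t <- J) psi t (Y t w)).
Proof.
elim: J => [|t J IH].
  by under eq_fun do rewrite big_nil; exact: measurable_cst.
under eq_fun do rewrite big_cons; apply: measurable_funM => //.
exact: measurable_discrete_comp.
Qed.

Lemma prod_psi_itv (J : seq I) w : 0 <= \prod_(t <- J) psi t (Y t w) <= 1.
Proof.
rewrite prodr_ge0/=; last by move=> t _; case/andP: (psi01 t (Y t w)).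
by apply: prodr_ile1 => t _; exact: psi01.
Qed.

Lemma measurable_joint_event (J : seq I) (A : I -> set 'rV[nat]_d) :
  measurable (\bigcap_(t in [set` J]) Y t @^-1` A t).
Proof.
rewrite bigcap_seq; apply: bigsetI_measurable => t _.
exact: measurable_fiber.
Qed.

(** Pass from events to functions one variable at a time. The events over [J2] are
carried along because conditioning on the value of the next variable turns it
into one more event. *)
Lemma indep_integral_prod_in (J1 J2 : seq I) (A : I -> set 'rV[nat]_d) :
  uniq (J1 ++ J2) -> (forall t, t \in J1 ++ J2 -> D t) ->
  (\int[P]_(w in \bigcap_(t in [set` J2]) Y t @^-1` A t)
     (\prod_(t <- J1) psi t (Y t w))%:E =
   \prod_(t <- J1) (\int[P]_w (psi t (Y t w))%:E) *
   \prod_(t <- J2) P (Y t @^-1` A t))%E.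
Proof.
elim: J1 J2 A => [|t J1 IH] J2 A uJ JD.
  under eq_integral do rewrite big_nil.
  rewrite big_nil mul1e integral_cst/= ?mul1e; first exact: indep_seq.
  exact: measurable_joint_event.
have psi0 u k : (0 <= (psi u k)%:E)%E by rewrite lee_fin; case/andP: (psi01 u k).
have mpsi u : measurable_fun setT (fun w => (psi u (Y u w))%:E).
  by apply/measurable_EFinP; exact: measurable_discrete_comp.
have mprod J : measurable_fun setT (fun w => (\prod_(u <- J) psi u (Y u w))%:E).
  by apply/measurable_EFinP; exact: measurable_prod_psi.
have prod0 J w : (0 <= (\prod_(u <- J) psi u (Y u w))%:E)%E.
  by rewrite lee_fin; case/andP: (prod_psi_itv J w).
set c := (\prod_(u <- J1) (\int[P]_w (psi u (Y u w))%:E) *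
   \prod_(u <- J2) P (Y u @^-1` A u))%E.
have c0 : (0 <= c)%E.
  rewrite mule_ge0//; last by apply: prode_ge0.
  by apply: prode_ge0 => u _; apply: integral_ge0 => w _.
rewrite big_cons -muleA -/c -ge0_integralZr//.
apply: (eq_integral_fibers (Y1 := Y t) (Y2 := Y t)) => //.
- exact: measurable_joint_event.
- exact: emeasurable_funM.
- by move=> w; rewrite mule_ge0.
(* the value k of Y t becomes the event attached to t *)
move=> k; pose A' u := if u == t then [set k] else A u.
have tJ : t \notin J1 ++ J2 by case/andP: uJ.
have J2A u : u \in J2 -> A' u = A u.
  rewrite /A'; case: eqP => // -> tJ2.
  by move: tJ; rewrite mem_cat tJ2 orbT.
have -> : (\bigcap_(u in [set` J2]) Y u @^-1` A u) `&` Y t @^-1` [set k] =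
    \bigcap_(u in [set` t :: J2]) Y u @^-1` A' u.
  rewrite !bigcap_seq big_cons {1}/A' eqxx setIC; congr (_ `&` _).
  by apply: eq_big_seq => u /J2A ->.
transitivity (\int[P]_(w in \bigcap_(u in [set` t :: J2]) Y u @^-1` A' u)
    ((psi t k)%:E * (\prod_(u <- J1) psi u (Y u w))%:E))%E.
  apply: eq_integral => w /set_mem /(_ t); rewrite /= mem_head => /(_ isT).
  by rewrite /A' eqxx /= big_cons EFinM => ->.
rewrite ge0_integralZl//; last 2 first.
  exact: measurable_joint_event.
  exact: measurable_funTS.
have perm : perm_eq (J1 ++ t :: J2) (t :: J1 ++ J2).
  by apply/permPl; exact: (perm_catCA J1 [:: t]).
rewrite IH; last 2 first.
  by rewrite (perm_uniq perm).
  by move=> u; rewrite (perm_mem perm); exact: JD.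
have EA : (\prod_(u <- J2) P (Y u @^-1` A' u) =
    \prod_(u <- J2) P (Y u @^-1` A u))%E.
  by apply: eq_big_seq => u /J2A ->.
rewrite big_cons EA (_ : A' t = [set k]) /A' ?eqxx// setTI.
transitivity (\int[P]_(w in Y t @^-1` [set k]) ((psi t k)%:E * c))%E; last first.
  by apply: eq_integral => w /set_mem /= ->.
rewrite integral_cst; last exact: measurable_fiber.
rewrite -[RHS]muleA; congr (_ * _)%E.
by rewrite muleCA muleC.
Qed.

Lemma indep_integral_prod (J : seq I) :
  uniq J -> (forall t, t \in J -> D t) ->
  (\int[P]_w (\prod_(t <- J) psi t (Y t w))%:E =
   \prod_(t <- J) (\int[P]_w (psi t (Y t w))%:E))%E.
Proof.
move=> uJ JD; have := @indep_integral_prod_in J [::] (fun=> setT).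
rewrite cats0 big_nil mule1 => /(_ uJ JD) <-.
by rewrite bigcap_seq big_nil.
Qed.

End independence.

(** * Means of bounded functions *)

Section bounded_expectations.
Context {dsp : measure_display} {T : measurableType dsp} {R : realType}
  (P : probability T R).
Implicit Types f g : T -> R.

(** Under a probability these functions are integrable, and they are stable under
sums and products, so that integrability never needs a separate argument. *)
Definition bounded_measurable f :=
  measurable_fun setT f /\ exists M, forall w, `|f w| <= M.

Lemma bounded_measurable_integrable f :
  bounded_measurable f -> P.-integrable setT (EFin \o f).
Proof. by move=> [mf [M fM]]; exact: bounded_integrable fM. Qed.

Lemma bounded_measurable_lin a f g :
  bounded_measurable f -> bounded_measurable g ->
  bounded_measurable (fun w => a * f w + g w).
Proof.
move=> [mf [M fM]] [mg [L gL]]; split.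
  by apply: measurable_funD => //; exact: measurable_funM.
exists (`|a| * M + L) => w; rewrite (le_trans (ler_normD _ _))// lerD//.
by rewrite normrM ler_wpM2l.
Qed.

Lemma bounded_measurableM f g :
  bounded_measurable f -> bounded_measurable g ->
  bounded_measurable (fun w => f w * g w).
Proof.
move=> [mf [M fM]] [mg [L gL]]; split; first exact: measurable_funM.
by exists (M * L) => w; rewrite normrM ler_pM.
Qed.

Lemma bounded_measurable_rv d (Y : {RV P >-> 'rV[nat]_d})
    (phi : 'rV[nat]_d -> R) (M : R) :
  (forall k, `|phi k| <= M) -> bounded_measurable (fun w => phi (Y w)).
Proof.
by move=> phiM; split; [exact: measurable_discrete_comp | exists M].
Qed.

Lemma Rintegral_lin a f g : bounded_measurable f -> bounded_measurable g ->
  \int[P]_w (a * f w + g w) = a * (\int[P]_w f w) + \int[P]_w g w.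
Proof.
move=> bf bg; have af : bounded_measurable (fun w => a * f w).
  split; first by apply: measurable_funM => //; case: bf.
  case: bf => _ [M fM]; exists (`|a| * M) => w.
  by rewrite normrM ler_wpM2l.
rewrite RintegralD//; try exact: bounded_measurable_integrable.
by rewrite RintegralZl//; exact: bounded_measurable_integrable.
Qed.

Lemma Rintegral_cst1 (c : R) : \int[P]_w c = c.
Proof.
rewrite Rintegral_cst//.
have -> : fine (P setT) = 1 by rewrite probability_setT.
by rewrite mulr1.
Qed.

Lemma le_normr_Rintegral_bound f (e : R) :
  measurable_fun setT f -> (forall w, `|f w| <= e) -> `|\int[P]_w f w| <= e.
Proof.
move=> mf fe.
have bf : bounded_measurable f by split=> //; exists e.
have bnf : bounded_measurable (fun w => `|f w|).
  by split; [exact: measurableT_comp|exists e => w; rewrite normr_id].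
rewrite (le_trans (le_normr_Rintegral _ _))//.
  exact: bounded_measurable_integrable.
rewrite -[leRHS]Rintegral_cst1.
apply: le_Rintegral => //; try exact: bounded_measurable_integrable.
by apply: bounded_measurable_integrable; split; [exact: measurable_cst|exists `|e|].
Qed.

Lemma dist_Rintegral_le f g h :
  bounded_measurable f -> bounded_measurable g -> bounded_measurable h ->
  (forall w, `|f w - g w| <= h w) ->
  `|\int[P]_w f w - \int[P]_w g w| <= \int[P]_w h w.
Proof.
move=> bf bg bh fgh; pose If := @bounded_measurable_integrable.
rewrite -RintegralB//; [|exact: If..].
have fgE : (fun w => f w - g w) = (fun w => -1 * g w + f w).
  by apply/funext => w; rewrite mulN1r addrC.
have bfg : bounded_measurable (fun w => f w - g w).
  by rewrite fgE; exact: bounded_measurable_lin.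
rewrite (le_trans (le_normr_Rintegral _ _))//; first exact: If.
apply: le_Rintegral => //; last exact: If.
apply: If; case: bfg => mfg [M fgM]; split; first exact: measurableT_comp.
by exists M => w; rewrite normr_id.
Qed.

Lemma EFin_Rintegral f : bounded_measurable f ->
  ((\int[P]_w f w)%R%:E = \int[P]_w (f w)%:E)%E.
Proof.
move=> bf; rewrite /Rintegral fineK//.
by apply: integrable_fin_num => //; exact: bounded_measurable_integrable.
Qed.

End bounded_expectations.

(** * Bernoulli laws *)

Section Bernoulli_law.
Context {dsp : measure_display} {T : measurableType dsp} {R : realType}
  (P : probability T R) (d : nat) (Y : {RV P >-> 'rV[nat]_d}) (p : 'rV[R]_d).
Hypothesis lawY : has_law Y (Bernoulli p).

Let e (i : 'I_d) : 'rV[nat]_d := delta_mx ord0 i.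

Lemma delta_mx_row_inj : injective e.
Proof.
move=> i j /(congr1 (fun v : 'rV[nat]_d => v ord0 i)).
by rewrite !mxE !eqxx; case: eqP.
Qed.

Lemma delta_mx_row_neq0 i : e i != 0.
Proof.
apply/eqP => /(congr1 (fun v : 'rV[nat]_d => v ord0 i)).
by rewrite !mxE !eqxx.
Qed.

Lemma Bernoulli_set1 k : Bernoulli p [set k] =
  (\sum_(i < d) p ord0 i * (k == e i)%:R +
   (1 - \sum_(i < d) p ord0 i) * (k == 0)%:R)%:E.
Proof.
rewrite /Bernoulli [RHS]EFinD -sumEFin; congr (_ + _)%E.
  apply: eq_bigr => i _; rewrite EFinM diracE; congr (_ * _%:R%:E)%E.
  by congr nat_of_bool; apply/idP/eqP => [/set_mem/= <-|->]//; exact/mem_set.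
rewrite [RHS]EFinM diracE; congr (_ * _%:R%:E)%E.
by congr nat_of_bool; apply/idP/eqP => [/set_mem/= <-|->]//; exact/mem_set.
Qed.

Lemma law_fiber k : P (Y @^-1` [set k]) = Bernoulli p [set k].
Proof. by rewrite -lawY. Qed.

Lemma Bernoulli_delta i : P (Y @^-1` [set e i]) = (p ord0 i)%:E.
Proof.
rewrite law_fiber Bernoulli_set1 (negbTE (delta_mx_row_neq0 i)) mulr0 addr0.
rewrite (bigD1 i)//= eqxx mulr1 big1 ?addr0// => j ji.
by rewrite (inj_eq delta_mx_row_inj) eq_sym (negbTE ji) mulr0.
Qed.

Lemma Bernoulli_0 : P (Y @^-1` [set 0]) = (1 - \sum_(i < d) p ord0 i)%:E.
Proof.
rewrite law_fiber Bernoulli_set1 eqxx mulr1 big1 ?add0r// => i _.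
by rewrite eq_sym (negbTE (delta_mx_row_neq0 i)) mulr0.
Qed.

Lemma Bernoulli_param_ge0 i : 0 <= p ord0 i.
Proof. by rewrite -lee_fin -Bernoulli_delta. Qed.

Lemma Bernoulli_param_le1 : \sum_(i < d) p ord0 i <= 1.
Proof. by rewrite -subr_ge0 -lee_fin -Bernoulli_0. Qed.

(** On each fiber of positive probability [f] agrees with the combination of the
indicators of 0 and of the basis vectors that has the same values there; the
other fibers are null. *)
Lemma Bernoulli_integral (f : 'rV[nat]_d -> R) : (forall k, 0 <= f k) ->
  (\int[P]_w (f (Y w))%:E =
   (f 0 * (1 - \sum_(i < d) p ord0 i) + \sum_(i < d) f (e i) * p ord0 i)%:E)%E.
Proof.
move=> f0.
pose ind k w : R := (Y w == k)%:R.
pose h w : \bar R := ((f 0 * ind 0 w)%:E + \sum_(i < d) (f (e i) * ind (e i) w)%:E)%E.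
have ind0 k w : 0 <= ind k w by rewrite ler0n.
have mind k : measurable_fun setT (fun w => (f k * ind k w)%:E).
  apply/measurable_EFinP.
  exact: (@measurable_discrete_comp _ _ _ P _ _ _ Y (fun l => f k * (l == k)%:R)).
have fi0 k w : (0 <= (f k * ind k w)%:E)%E by rewrite lee_fin mulr_ge0.
have int_ind k : (\int[P]_w (f k * ind k w)%:E = (f k)%:E * P (Y @^-1` [set k]))%E.
  under eq_integral do rewrite EFinM.
  rewrite ge0_integralZl//; last 3 first.
  - apply/measurable_EFinP.
    exact: (@measurable_discrete_comp _ _ _ P _ _ _ Y (fun l => (l == k)%:R : R)).
  - by move=> w _; rewrite lee_fin.
  - by rewrite lee_fin.
  congr (_ * _)%E; rewrite -[X in P X]setIT -integral_indic//; last exact: measurable_fiber.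
  apply: eq_integral => w _; rewrite indicE; congr (_%:R%:E).
  by congr nat_of_bool; apply/eqP/idP => [Yk|/set_mem//]; exact/mem_set.
have -> : (\int[P]_w (f (Y w))%:E = \int[P]_w h w)%E.
  apply: (eq_integral_fibers (Y1 := Y) (Y2 := Y)) => //.
  - by apply/measurable_EFinP; exact: measurable_discrete_comp.
  - by apply: emeasurable_funD => //; apply: emeasurable_sum.
  - by move=> w; rewrite lee_fin.
  - by move=> w; apply: adde_ge0 => //; apply: sume_ge0.
  move=> k; rewrite !setTI.
  pose hk := f 0 * (k == 0)%:R + \sum_(i < d) f (e i) * (k == e i)%:R.
  transitivity ((f k)%:E * P (Y @^-1` [set k]))%E.
    rewrite -integral_cst//; last exact: measurable_fiber.
    by apply: eq_integral => w /set_mem /= ->.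
  transitivity (hk%:E * P (Y @^-1` [set k]))%E; last first.
    rewrite -integral_cst//; last exact: measurable_fiber.
    apply: eq_integral => w /set_mem /= Yk.
    by rewrite /h sumEFin -EFinD /ind Yk.
  have [k0|k0] := eqVneq k 0.
    rewrite /hk k0 eqxx mulr1 big1 ?addr0// => i _.
    by rewrite eq_sym (negbTE (delta_mx_row_neq0 i)) mulr0.
  have [/existsP[i /eqP ki]|kN] := boolP [exists i, k == e i].
    rewrite /hk (negbTE k0) mulr0 add0r ki (bigD1 i)//= eqxx mulr1.
    rewrite big1 ?addr0// => j ji.
    by rewrite (inj_eq delta_mx_row_inj) eq_sym (negbTE ji) mulr0.
  rewrite law_fiber Bernoulli_set1 (negbTE k0) mulr0 addr0 big1 ?mule0//.
  by move=> i _; move: kN; rewrite negb_exists => /forallP/(_ i)/negbTE ->; rewrite mulr0.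
rewrite /h ge0_integralD//; last 2 first.
- by move=> w _; apply: sume_ge0.
- by apply: emeasurable_sum.
rewrite ge0_integral_sum// EFinD EFinM -Bernoulli_0 -sumEFin int_ind.
congr (_ + _)%E; apply: eq_bigr => i _.
by rewrite int_ind EFinM Bernoulli_delta.
Qed.

Lemma Bernoulli_mono (y : 'cV[R]_d) : (forall i, 0 <= y i 0 <= 1) ->
  (\int[P]_w (mono y (Y w))%:E = (1 - (p *m y) 0 0)%:E)%E.
Proof.
move=> y01; rewrite Bernoulli_integral; last first.
  by move=> k; case/andP: (mono_itv k y01).
have me i : mono y (e i) = 1 - y i 0 by exact: mono_delta.
congr EFin; rewrite mono0 mul1r mxE -addrA; congr (_ + _).
under [X in _ + X = _]eq_bigr do rewrite me mulrBl mul1r.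
rewrite sumrB addKr; congr (- _).
by apply: eq_bigr => i _; rewrite mulrC.
Qed.

End Bernoulli_law.

(** * Independence tested on monomials *)

Section monomial_independence.
Context {dsp : measure_display} {T : measurableType dsp} {R : realType}
  (P : probability T R) (d : nat).

Lemma bounded_measurable_mono (Z : {RV P >-> 'rV[nat]_d}) (y : 'cV[R]_d) :
  (forall i, 0 <= y i 0 <= 1) -> bounded_measurable (fun w => mono y (Z w)).
Proof.
move=> y01; apply: (@bounded_measurable_rv _ _ _ _ _ _ _ 1) => k.
by rewrite ger0_norm; case/andP: (mono_itv k y01).
Qed.

(** The functions [phi] for which [phi (Z)] and [W] factorize are stable under
linear combinations and uniform limits, and contain the monomials. *)
Lemma Rintegral_indicator_factor (Z : {RV P >-> 'rV[nat]_d}) (W : T -> R) (c : R) :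
  measurable_fun setT W -> (forall w, 0 <= W w <= 1) -> 0 <= c <= 1 ->
  (forall y : 'cV[R]_d, (forall i, 0 <= y i 0 < 1) ->
    \int[P]_w (mono y (Z w) * W w) = (\int[P]_w mono y (Z w)) * c) ->
  forall l, \int[P]_w ((Z w == l)%:R * W w) = (\int[P]_w (Z w == l)%:R) * c.
Proof.
move=> mW W01 /andP[c0 c1] Wmono l.
have bW : bounded_measurable W.
  by split=> //; exists 1 => w; rewrite ger0_norm; case/andP: (W01 w).
pose L (phi : 'rV[nat]_d -> R) := (exists M, forall k, `|phi k| <= M) /\
  \int[P]_w (phi (Z w) * W w) = (\int[P]_w phi (Z w)) * c.
suff : L (fun k => (k == l)%:R) by case.
have bL (phi : 'rV[nat]_d -> R) : (exists M, forall k, `|phi k| <= M) ->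
    bounded_measurable (fun w => phi (Z w)).
  by move=> [M phiM]; exact: (bounded_measurable_rv Z phiM).
apply: indicators_of_monomials.
- move=> a f g [bf fE] [bg gE]; split.
    move: bf bg => [M fM] [M' gM']; exists (`|a| * M + M') => k.
    by rewrite (le_trans (ler_normD _ _))// lerD// normrM ler_wpM2l.
  have Wf := bounded_measurableM (bL _ bf) bW.
  have Wg := bounded_measurableM (bL _ bg) bW.
  rewrite Rintegral_lin; [|exact: bL..].
  rewrite mulrDl -mulrA -fE -gE -Rintegral_lin//.
  by apply: eq_Rintegral => w _; rewrite mulrDl mulrA.
- move=> f fL; have bf : exists M, forall k, `|f k| <= M.
    have [g [[M gM] _] fg] := fL 1 ltr01.
    exists (1 + M) => k; rewrite -(subrK (g k) (f k)).
    by rewrite (le_trans (ler_normD _ _))// lerD.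
  split=> //; apply/eqP; rewrite -subr_eq0 -normr_le0.
  apply/ler_addgt0Pr => e e0; rewrite add0r.
  have [g [bg gE] fg] := fL (e / 2) ltac:(by rewrite divr_gt0).
  have -> : \int[P]_w (f (Z w) * W w) - (\int[P]_w f (Z w)) * c =
    \int[P]_w ((f (Z w) - g (Z w)) * W w) -
    (\int[P]_w (f (Z w) - g (Z w))) * c.
    under [X in _ = X - _]eq_Rintegral do rewrite mulrBl.
    rewrite !RintegralB//; try exact: bounded_measurable_integrable (bL _ _);
      try exact: bounded_measurable_integrable (bounded_measurableM (bL _ _) _).
    by rewrite gE mulrBl; lra.
  have mfg : measurable_fun setT (fun w => f (Z w) - g (Z w)).
    exact: (@measurable_discrete_comp _ _ _ P _ _ _ Z (fun k => f k - g k : R)).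
  rewrite (le_trans (ler_normB _ _))// (splitr e) lerD//.
    apply: le_normr_Rintegral_bound; first exact: measurable_funM.
    move=> w; rewrite normrM -[leRHS]mulr1 ler_pM//.
    by rewrite ger0_norm; case/andP: (W01 w).
  rewrite normrM -[leRHS]mulr1 ler_pM// ?(ger0_norm c0)//.
  exact: le_normr_Rintegral_bound.
- move=> y y1; have y01 i : 0 <= y i 0 <= 1.
    by case/andP: (y1 i) => -> /ltW.
  split; last exact: Wmono.
  by exists 1 => k; rewrite ger0_norm; case/andP: (mono_itv k y01).
Qed.

End monomial_independence.

Section independent_products.
Context {dsp : measure_display} {T : measurableType dsp} {R : realType}
  (P : probability T R) (I : choiceType) (D : set I) (d : nat)
  (Y : I -> {RV P >-> 'rV[nat]_d}) (psi : I -> 'rV[nat]_d -> R).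
Hypothesis psi01 : forall t k, 0 <= psi t k <= 1.

Lemma bounded_measurable_psi t : bounded_measurable (fun w => psi t (Y t w)).
Proof.
apply: (@bounded_measurable_rv _ _ _ _ _ _ _ 1) => k.
by rewrite ger0_norm; case/andP: (psi01 t k).
Qed.

Lemma bounded_measurable_prod_psi J :
  bounded_measurable (fun w => \prod_(t <- J) psi t (Y t w)).
Proof.
split; first exact: measurable_prod_psi.
by exists 1 => w; rewrite ger0_norm; case/andP: (prod_psi_itv Y psi01 J w).
Qed.

Lemma prod_Rintegral_itv J : 0 <= \prod_(t <- J) \int[P]_w psi t (Y t w) <= 1.
Proof.
have i01 t : 0 <= \int[P]_w psi t (Y t w) <= 1.
  rewrite Rintegral_ge0/=; last by move=> w _; case/andP: (psi01 t (Y t w)).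
  rewrite (le_trans (ler_norm _))// le_normr_Rintegral_bound//.
    by case: (bounded_measurable_psi t).
  by move=> w; rewrite ger0_norm; case/andP: (psi01 t (Y t w)).
rewrite prodr_ge0/=; last by move=> t _; case/andP: (i01 t).
by apply: prodr_ile1 => t _.
Qed.

Lemma EFin_prod_Rintegral J : ((\prod_(t <- J) \int[P]_w psi t (Y t w))%R%:E =
  \prod_(t <- J) \int[P]_w (psi t (Y t w))%:E)%E.
Proof.
rewrite -prodEFin; apply: eq_bigr => t _.
by rewrite EFin_Rintegral//; exact: bounded_measurable_psi.
Qed.

Lemma Rintegral_prod_psi (J : seq I) : mutually_independent D Y ->
  uniq J -> (forall t, t \in J -> D t) ->
  \int[P]_w (\prod_(t <- J) psi t (Y t w)) =
  \prod_(t <- J) \int[P]_w psi t (Y t w).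
Proof.
move=> indY uJ JD; apply: EFin_inj.
rewrite EFin_Rintegral; last exact: bounded_measurable_prod_psi.
by rewrite EFin_prod_Rintegral (indep_integral_prod indY).
Qed.

End independent_products.

(** * The generating function of the process *)

Section GWI.
Context {dsp : measure_display} {T : measurableType dsp} {R : realType}
  (P : probability T R) (d : nat)
  (xi : nat -> nat -> 'I_d -> {RV P >-> 'rV[nat]_d})
  (eps X : nat -> {RV P >-> 'rV[nat]_d})
  (X_GWI : is_GWI xi eps X)
  (xi_Be : Bernoulli_offspring xi) (eps_Be : Bernoulli_immigration eps)
  (B : nat -> 'M[R]_d) (m : nat -> 'rV[R]_d)
  (BE : forall n, (0 < n)%N -> B n = offspring_mean xi n)
  (mE : forall n, (0 < n)%N -> m n = immigration_mean eps n).

Definition gwi_time (t : (nat * nat * 'I_d) + nat) : nat :=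
  match t with inl (n, _, _) => n | inr n => n end.

Let Y := gwi_family xi eps.

Lemma offspring_law n j i : (0 < n)%N -> (0 < j)%N ->
  has_law (xi n j i) (Bernoulli (row i (B n))).
Proof.
by move=> n0 j0 A mA; rewrite (gwi_ident X_GWI)// xi_Be// BE.
Qed.

Lemma immigration_law n : (0 < n)%N -> has_law (eps n) (Bernoulli (m n)).
Proof. by move=> n0 A mA; rewrite eps_Be// mE. Qed.

Lemma immigration_mean_ge0 n i : (0 < n)%N -> 0 <= m n 0 i.
Proof. by move=> n0; exact: (Bernoulli_param_ge0 (immigration_law n0)). Qed.

Lemma itv_immigration_mean n (y : 'cV[R]_d) : (0 < n)%N ->
  (forall i, 0 <= y i 0 <= 1) -> 0 <= (m n *m y) 0 0 <= 1.
Proof.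
move=> n0 y01; rewrite mxE; apply/andP; split.
  apply: sumr_ge0 => i _; rewrite mulr_ge0 ?immigration_mean_ge0//.
  by case/andP: (y01 i).
apply: le_trans (Bernoulli_param_le1 (immigration_law n0)).
apply: ler_sum => i _; rewrite ler_piMr ?immigration_mean_ge0//.
by case/andP: (y01 i).
Qed.

Lemma itv_offspring_mean n (y : 'cV[R]_d) : (0 < n)%N ->
  (forall i, 0 <= y i 0 <= 1) -> forall i, 0 <= (B n *m y) i 0 <= 1.
Proof.
move=> n0 y01 i.
have law := offspring_law i n0 (ltn0Sn 0).
have B0 k : 0 <= B n i k.
  by have := Bernoulli_param_ge0 law k; rewrite mxE.
rewrite mxE; apply/andP; split.
  by apply: sumr_ge0 => k _; rewrite mulr_ge0//; case/andP: (y01 k).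
apply: le_trans (Bernoulli_param_le1 law).
by apply: ler_sum => k _; rewrite mxE ler_piMr//; case/andP: (y01 k).
Qed.

Lemma itv_mean_prod j n (y : 'cV[R]_d) : (j <= n)%N ->
  (forall i, 0 <= y i 0 <= 1) -> forall i, 0 <= (mean_prod B j n *m y) i 0 <= 1.
Proof.
elim: n y => [|n IH] y jn y01.
  by move: jn; rewrite leqn0 => /eqP ->; rewrite mean_prod_nn mul1mx.
move: jn; rewrite leq_eqVlt => /predU1P[->|jn].
  by rewrite mean_prod_nn mul1mx.
rewrite mean_prod_recr// -mulmxA; apply: IH => //.
exact: itv_offspring_mean.
Qed.

(** The indices of the variables that build generation [n] when the previous
generation is [l]. Conditionally on that event the random number of summands
is fixed, and the sum is over this list. *)
Definition generation (n : nat) (l : 'rV[nat]_d) : seq ((nat * nat * 'I_d) + nat) :=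
  inr n :: [seq inl (n, j, i) | i <- enum 'I_d, j <- index_iota 1 (l ord0 i).+1].

Lemma gwi_step_generation n w :
  X n.+1 w = \sum_(t <- generation n.+1 (X n w)) Y t w.
Proof.
rewrite (gwi_step X_GWI) big_cons addrC; congr (_ + _).
by rewrite big_allpairs_dep/= big_enum.
Qed.

Lemma generationP n l t : (0 < n)%N -> t \in generation n l ->
  gwi_index t /\ gwi_time t = n.
Proof.
move=> n0; rewrite inE => /predU1P[->//|/allpairsPdep[i [j [_ + ->]]]].
by rewrite mem_index_iota /gwi_index/= n0 => /andP[->].
Qed.

Lemma generation_uniq n l : uniq (generation n l).
Proof.
rewrite /= allpairs_uniq_dep ?enum_uniq//; last 2 first.
- by move=> i _; exact: iota_uniq.
- by move=> [i j] [i' j'] _ _ /= [-> ->].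
by rewrite andbT; apply/negP => /allpairsPdep[i [j []]].
Qed.

(** By independence the left-hand side is the generating function of generation
[n] when the previous one is [l]: the product over the individuals of type [i]
is a power with exponent [l ord0 i], hence the monomial at [B n *m y]. *)
Lemma generation_mono n l (y : 'cV[R]_d) : (0 < n)%N -> (forall i, 0 <= y i 0 <= 1) ->
  (\prod_(t <- generation n l) \int[P]_w (mono y (Y t w))%:E =
   ((1 - (m n *m y) 0 0) * mono (B n *m y) l)%:E)%E.
Proof.
move=> n0 y01; rewrite big_cons EFinM; congr (_ * _)%E.
  exact: (Bernoulli_mono (immigration_law n0) y01).
rewrite big_allpairs_dep/= big_enum/= /mono -prodEFin.
apply: eq_bigr => i _.
transitivity (\prod_(1 <= j < (l ord0 i).+1) (1 - (B n *m y) i 0)%:E)%E.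
  apply: eq_big_nat => j /andP[j0 _].
  rewrite (Bernoulli_mono (offspring_law i n0 j0) y01).
  by rewrite -row_mul mxE.
by rewrite prodEFin prodr_const_nat subSS subn0.
Qed.

Definition pgf n (y : 'cV[R]_d) : R :=
  \prod_(1 <= j < n.+1) (1 - (m j *m mean_prod B j n *m y) 0 0).

Lemma pgf_recr n y :
  pgf n.+1 y = pgf n (B n.+1 *m y) * (1 - (m n.+1 *m y) 0 0).
Proof.
rewrite /pgf big_nat_recr//= mean_prod_nn mulmx1; congr (_ * _).
apply: eq_big_nat => j /andP[_ jn]; congr (1 - _ 0 0).
by rewrite mean_prod_recr// !mulmxA.
Qed.

(** The factors [psi] of variables of later times make the induction possible.
They express that the past is independent of the future, and the variables of
generation [n + 1] are among them when the step from [n] to [n + 1]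
conditions on the value of [X n]. *)
Lemma gwi_pgf_joint n (y : 'cV[R]_d) (J : seq ((nat * nat * 'I_d) + nat))
    (psi : (nat * nat * 'I_d) + nat -> 'rV[nat]_d -> R) :
  (forall i, 0 <= y i 0 <= 1) -> (forall t k, 0 <= psi t k <= 1) ->
  uniq J -> (forall t, t \in J -> gwi_index t /\ (n < gwi_time t)%N) ->
  \int[P]_w (mono y (X n w) * \prod_(t <- J) psi t (Y t w)) =
  pgf n y * \prod_(t <- J) \int[P]_w psi t (Y t w).
Proof.
elim: n y J psi => [|n IH] y J psi y01 psi01 uJ JD.
  rewrite /pgf big_geq// mul1r.
  transitivity (\int[P]_w (\prod_(t <- J) psi t (Y t w))).
    by apply: eq_Rintegral => w _; rewrite (gwi_init X_GWI) mono0 mul1r.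
  by rewrite (Rintegral_prod_psi psi01 (gwi_indep X_GWI))// => t /JD[].
have pgfE (y' : 'cV[R]_d) : (forall i, 0 <= y' i 0 <= 1) ->
    \int[P]_w mono y' (X n w) = pgf n y'.
  move=> y'01; have := IH y' [::] psi y'01 psi01 isT.
  rewrite big_nil mulr1 => <-//.
  by apply: eq_Rintegral => w _; rewrite big_nil mulr1.
(* one family for generation n + 1 and the later variables: they are told
   apart by their times *)
pose Q t := if gwi_time t == n.+1 then mono y else psi t.
have Q01 t k : 0 <= Q t k <= 1 by rewrite /Q; case: ifP => _; rewrite ?mono_itv.
pose c := \prod_(t <- J) \int[P]_w psi t (Y t w).
pose h := 1 - (m n.+1 *m y) 0 0.
have QJ t : t \in J -> Q t = psi t.
  by move=> /JD[_]; rewrite /Q; case: eqP => // ->; rewrite ltnn.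
have Qgen l t : t \in generation n.+1 l -> Q t = mono y.
  by move=> /(generationP (ltn0Sn n))[_ tn]; rewrite /Q tn eqxx.
have uniq_all l : uniq (generation n.+1 l ++ J).
  rewrite cat_uniq generation_uniq uJ andbT/=.
  apply/hasPn => t /JD[_ nt]; apply/negP => /(generationP (ltn0Sn n))[_ tn].
  by rewrite tn ltnn in nt.
have all_index l t : t \in generation n.+1 l ++ J ->
    gwi_index t /\ (n < gwi_time t)%N.
  rewrite mem_cat => /orP[/(generationP (ltn0Sn n))[? ->]//|/JD[? /ltnW]//].
have By01 := itv_offspring_mean (ltn0Sn n) y01.
have past l : \int[P]_w ((X n w == l)%:R *
      \prod_(t <- generation n.+1 l ++ J) Q t (Y t w)) =
    (\int[P]_w (X n w == l)%:R) * (h * mono (B n.+1 *m y) l * c).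
  rewrite (@Rintegral_indicator_factor _ _ _ _ _ _ _
    (\prod_(t <- generation n.+1 l ++ J) \int[P]_w Q t (Y t w))).
  - congr (_ * _); rewrite big_cat/=; congr (_ * _); last first.
      by apply: eq_big_seq => t /QJ ->.
    apply: EFin_inj; rewrite -generation_mono// EFin_prod_Rintegral//.
    by apply: eq_big_seq => t /Qgen ->.
  - exact: measurable_prod_psi.
  - exact: prod_psi_itv.
  - exact: prod_Rintegral_itv.
  - move=> y' y'1; have y'01 i : 0 <= y' i 0 <= 1.
      by case/andP: (y'1 i) => -> /ltW.
    by rewrite pgfE//; apply: IH => //; exact: all_index.
rewrite pgf_recr -pgfE// -/h -/c -mulrA.
have bmy := bounded_measurable_mono (X n.+1) y01.
have bmBy := bounded_measurable_mono (X n) By01.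
have bWJ := bounded_measurable_prod_psi Y psi01 J.
have b0 l : bounded_measurable (fun w => (X n w == l)%:R : R).
  apply: (bounded_measurable_rv (X n) (phi := fun k => (k == l)%:R : R)
    (M := 1)) => k.
  by case: eqP => _; rewrite ?normr0 ?normr1 ?ler01.
have h01 : 0 <= h.
  by rewrite subr_ge0; case/andP: (itv_immigration_mean (ltn0Sn n) y01).
have /andP[c0 _] : 0 <= c <= 1 by exact: prod_Rintegral_itv.
have mono_ge0 n' (y' : 'cV[R]_d) w :
    (forall i, 0 <= y' i 0 <= 1) -> 0 <= mono y' (X n' w).
  by move=> y'01; case/andP: (mono_itv (X n' w) y'01).
rewrite -RintegralZr//; last exact: bounded_measurable_integrable.
have fiberE (f : T -> R) l : (\int[P]_(w in setT `&` X n @^-1` [set l]) (f w)%:E =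
    \int[P]_w ((X n w == l)%:R * f w)%:E)%E.
  rewrite setTI integral_mkcond; apply: eq_integral => w _.
  rewrite patchE; case: eqP => [Xl|Xl].
    by rewrite mul1r mem_set.
  by rewrite mul0r memNset.
congr fine; apply: (eq_integral_fibers (Y1 := X n) (Y2 := X n)) => //.
- apply/measurable_EFinP; apply: measurable_funM; first by case: bmy.
  by case: bWJ.
- by apply/measurable_EFinP; apply: measurable_funM; first by case: bmBy.
- move=> w; rewrite lee_fin mulr_ge0 ?mono_ge0//.
  by case/andP: (prod_psi_itv Y psi01 J w).
- by move=> w; rewrite lee_fin !mulr_ge0 ?mono_ge0.
move=> l; rewrite !fiberE.
transitivity (\int[P]_w ((X n w == l)%:R *
    \prod_(t <- generation n.+1 l ++ J) Q t (Y t w))%:E)%E.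
  apply: eq_integral => w _; congr EFin; case: eqP => [Xl|]; last by rewrite !mul0r.
  rewrite !mul1r gwi_step_generation mono_sum Xl big_cat/=; congr (_ * _).
    by apply: eq_big_seq => t /Qgen ->.
  by apply: eq_big_seq => t /QJ ->.
rewrite -EFin_Rintegral; last first.
  apply: bounded_measurableM => //; exact: bounded_measurable_prod_psi.
rewrite past -RintegralZr//; last exact: bounded_measurable_integrable.
rewrite EFin_Rintegral.
  apply: eq_integral => w _; congr EFin.
  by case: eqP => [->|]; rewrite ?mul0r// !mul1r mulrA (mulrC h).
have bc : bounded_measurable (fun _ : T => h * mono (B n.+1 *m y) l * c).
  by split; [exact: measurable_cst|exists `|h * mono (B n.+1 *m y) l * c|].
exact: bounded_measurableM.
Qed.

Lemma gwi_pgf n (y : 'cV[R]_d) : (forall i, 0 <= y i 0 <= 1) ->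
  \int[P]_w mono y (X n w) = pgf n y.
Proof.
move=> y01; pose psi (_ : (nat * nat * 'I_d) + nat) (_ : 'rV[nat]_d) : R := 0.
transitivity (\int[P]_w (mono y (X n w) * \prod_(t <- [::]) psi t (Y t w))).
  by apply: eq_Rintegral => w _; rewrite big_nil mulr1.
rewrite gwi_pgf_joint// ?big_nil ?mulr1// => t k.
by rewrite lexx ler01.
Qed.

End GWI.

(** * Poisson laws *)

Section Poisson_law.
Context {R : realType} (d : nat).

(** The weight [s ^+ k] turns the rate [r] into [r * s], up to the normalization
[expR (- (r * (1 - s)))]. This holds at rate 0 as well, where the law is the
point mass at 0. *)
Lemma poisson_prob_set1_tilt (r s : R) k : 0 <= r -> 0 < s ->
  ((s ^+ k)%:E * (poisson_prob r 0%N : set nat -> \bar R) [set k] =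
   (expR (- (r * (1 - s))))%:E *
   (poisson_prob (r * s) 0%N : set nat -> \bar R) [set k])%E.
Proof.
rewrite le_eqVlt => /predU1P[<-|r0] s0.
  rewrite !mul0r oppr0 expR0 mul1e /poisson_prob ltxx diracE.
  have [<-|k0] := eqVneq 0%N k; first by rewrite expr0 mul1e.
  by rewrite memNset ?mule0//= => /eqP; rewrite (negbTE k0).
rewrite /poisson_prob r0 mulr_gt0//.
rewrite !esum_set1 ?lee_fin ?poisson_pmf_ge0//.
rewrite -!EFinM /poisson_pmf r0 mulr_gt0//; congr EFin.
have -> : expR (- r) = expR (- (r * (1 - s))) * expR (- (r * s)).
  by rewrite -expRD; congr expR; lra.
rewrite exprMn; ring.
Qed.

Lemma Poisson_set1 (lam : 'rV[R]_d) (k : 'rV[nat]_d) :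
  Poisson lam [set k] =
  (\prod_(i < d) (poisson_prob (lam ord0 i) 0%N : set nat -> \bar R)
     [set k ord0 i])%E.
Proof.
rewrite /Poisson /= /prod_law esum_set1//.
by apply: prode_ge0 => i _; exact: measure_ge0.
Qed.

Lemma eq_integral_points (mu nu : probability 'rV[nat]_d R)
    (f g : 'rV[nat]_d -> R) : (forall k, 0 <= f k) -> (forall k, 0 <= g k) ->
  (forall k, (f k)%:E * mu [set k] = (g k)%:E * nu [set k])%E ->
  (\int[mu]_k (f k)%:E = \int[nu]_k (g k)%:E)%E.
Proof.
move=> f0 g0 fg.
have int_point (rho : probability 'rV[nat]_d R) (h : 'rV[nat]_d -> R) k :
    (\int[rho]_(l in [set k]) (h l)%:E = (h k)%:E * rho [set k])%E.
  by rewrite -integral_cst//; apply: eq_integral => l /set_mem /= ->.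
apply: (@eq_integral_fibers _ _ _ _ R d mu nu id id setT setT);
  [by []|by []|by []|by []|by []|by []|..].
- by move=> k; rewrite lee_fin.
- by move=> k; rewrite lee_fin.
by move=> k; rewrite !setTI !preimage_id !int_point.
Qed.

(** By tilting, the integral is the normalization constant times the total mass of
another Poisson law; no series is summed. *)
Lemma Poisson_mono (lam : 'rV[R]_d) (y : 'cV[R]_d) :
  (forall i, 0 <= lam 0 i) -> (forall i, 0 <= y i 0 < 1) ->
  \int[Poisson lam]_k mono y k = expR (- (lam *m y) 0 0).
Proof.
move=> lam0 y01.
pose tilted : 'rV[R]_d := \row_i (lam 0 i * (1 - y i 0)).
pose c := expR (- (lam *m y) 0 0).
have s0 i : 0 < 1 - y i 0 by rewrite subr_gt0; case/andP: (y01 i).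
have y01' i : 0 <= y i 0 <= 1 by case/andP: (y01 i) => -> /ltW.
rewrite /Rintegral -[RHS]/(fine (c%:E)); congr fine.
transitivity (\int[Poisson tilted]_k (cst c%:E k))%E; last first.
  rewrite integral_cst// -[RHS]mule1; congr (_ * _)%E.
  exact: probability_setT.
apply: eq_integral_points => [k|k|k].
- by case/andP: (mono_itv k y01').
- exact: expR_ge0.
rewrite !Poisson_set1 /mono -prodEFin -big_split/=.
rewrite /c mxE -sumrN expR_sum -prodEFin -big_split/=.
apply: eq_bigr => i _; rewrite poisson_prob_set1_tilt// mxE subKr.
by [].
Qed.

End Poisson_law.

(** * From generating functions to laws *)

Section continuity.
Context {dsp : measure_display} {T : measurableType dsp} {R : realType}
  (P : probability T R) (d : nat) (X : nat -> {RV P >-> 'rV[nat]_d})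
  (mu : probability 'rV[nat]_d R).

Hypothesis cvg_mono : forall y : 'cV[R]_d, (forall i, 0 <= y i 0 < 1) ->
  \int[P]_w mono y (X n w) @[n --> \oo] --> \int[mu]_k mono y k.

Let cvg_mean (phi : 'rV[nat]_d -> R) := (exists M, forall k, `|phi k| <= M) /\
  \int[P]_w phi (X n w) @[n --> \oo] --> \int[mu]_k phi k.

Let bX (phi : 'rV[nat]_d -> R) n : (exists M, forall k, `|phi k| <= M) ->
  bounded_measurable (fun w => phi (X n w)).
Proof. by move=> [M phiM]; exact: (bounded_measurable_rv (X n) phiM). Qed.

Let bmu (phi : 'rV[nat]_d -> R) : (exists M, forall k, `|phi k| <= M) ->
  bounded_measurable phi.
Proof. by move=> phiM; split. Qed.

Lemma cvg_mean_lin a f g : cvg_mean f -> cvg_mean g ->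
  cvg_mean (fun k => a * f k + g k).
Proof.
move=> [bf cf] [bg cg]; split.
  move: bf bg => [M fM] [M' gM']; exists (`|a| * M + M') => k.
  by rewrite (le_trans (ler_normD _ _))// lerD// normrM ler_wpM2l.
rewrite Rintegral_lin; [|exact: bmu..].
rewrite (_ : (fun n => _) = (fun n =>
    a * (\int[P]_w f (X n w)) + \int[P]_w g (X n w))).
  by apply: cvgD => //; exact: cvgMr.
by apply/funext => n; rewrite Rintegral_lin//; exact: bX.
Qed.

Lemma dist_mean_le n f g e : (exists M, forall k, `|f k| <= M) ->
  (exists M, forall k, `|g k| <= M) -> (forall k, `|f k - g k| <= e) ->
  `|\int[P]_w f (X n w) - \int[P]_w g (X n w)| <= e /\
  `|\int[mu]_k f k - \int[mu]_k g k| <= e.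
Proof.
move=> bf bg fg.
rewrite -!RintegralB//;
  try exact: bounded_measurable_integrable (bmu _);
  try exact: bounded_measurable_integrable (bX _ _).
split; apply: le_normr_Rintegral_bound => //.
exact: (@measurable_discrete_comp _ _ _ P _ _ _ (X n) (fun k => f k - g k : R)).
Qed.

Lemma cvg_mean_indicator l : cvg_mean (fun k => (k == l)%:R).
Proof.
apply: indicators_of_monomials => [a f g|f fL|y y1].
- exact: cvg_mean_lin.
- have bf : exists M, forall k, `|f k| <= M.
    have [g [[M gM] _] fg] := fL 1 ltr01.
    exists (1 + M) => k; rewrite -(subrK (g k) (f k)).
    by rewrite (le_trans (ler_normD _ _))// lerD.
  split=> //; apply/cvgrPdist_le => e e0.
  have e3 : 0 < e / 3 by rewrite divr_gt0.
  have [g [bg cg] fg] := fL _ e3.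
  move/cvgrPdist_le : cg => /(_ _ e3); apply: filterS => n gn.
  have [d1 d2] := dist_mean_le n bf bg fg.
  move: d1 d2 gn; rewrite !ler_norml => /andP[? ?] /andP[? ?] /andP[? ?].
  by apply/andP; split; lra.
- have y01 i : 0 <= y i 0 <= 1 by case/andP: (y1 i) => -> /ltW.
  split; last exact: cvg_mono.
  by exists 1 => k; rewrite ger0_norm; case/andP: (mono_itv k y01).
Qed.

(** Truncation to the first [N] points of an enumeration of the lattice leaves a
linear combination of point indicators. *)
Lemma cvg_mean_finite (f : 'rV[nat]_d -> R) N :
  cvg_mean (fun k => if (pickle k < N)%N then f k else 0).
Proof.
elim: N => [|N [bf cf]].
  split; first by exists 0 => k; rewrite ltn0 normr0.
  rewrite (_ : (fun n => _) = fun=> \int[mu]_k 0); first exact: cvg_cst.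
  apply/funext => n; rewrite -[LHS]/(\int[P]_w 0) !Rintegral_cst//.
  by rewrite !mul0r.
case Ek : (@pickle_inv 'rV[nat]_d N) => [k0|]; last first.
  rewrite (_ : (fun k => _) = (fun k => if (pickle k < N)%N then f k else 0))//.
  apply/funext => k; rewrite ltnS leq_eqVlt; case: eqP => // kN.
  by move: Ek; rewrite -kN pickleK_inv.
rewrite (_ : (fun k => _) = (fun k => f k0 * (k == k0)%:R +
    (if (pickle k < N)%N then f k else 0))).
  by apply: cvg_mean_lin; [exact: cvg_mean_indicator|].
have k0N : pickle k0 = N by have := @pickle_invK 'rV[nat]_d N; rewrite Ek.
apply/funext => k; rewrite ltnS leq_eqVlt -k0N.
rewrite (inj_eq (pcan_inj pickleK)).
case: eqP => [->|] /=; first by rewrite ltnn mulr1 addr0.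
by rewrite mulr0 add0r.
Qed.

(** The limit is a probability, so finitely many points carry almost all of its
mass; by [cvg_mean_finite] they eventually carry almost all the mass of the
laws that converge to it. *)
Lemma tightness (e : R) : 0 < e -> exists N,
  1 - e <= \int[mu]_k (if (pickle k < N)%N then 1 else 0).
Proof.
move=> e0; pose K N := [set k : 'rV[nat]_d | (pickle k < N)%N].
have KE N : \int[mu]_k (if (pickle k < N)%N then 1 else 0) = fine (mu (K N)).
  rewrite -[X in mu X]setIT -integral_indic//; congr fine.
  apply: eq_integral => k _; rewrite indicE.
  by case: ifPn => kN; [rewrite mem_set|rewrite memNset//; exact/negP].
have Kcvg : mu (K N) @[N --> \oo] --> mu (\bigcup_N K N).
  apply: nondecreasing_cvg_mu => // N N' NN'.
  by apply/subsetPset => k /= /leq_trans; apply.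
have : fine (mu (K N)) @[N --> \oo] --> fine (mu (\bigcup_N K N)).
  apply: fine_cvg; rewrite fineK//; exact: fin_num_measure.
rewrite (_ : \bigcup_N K N = setT); last first.
  by apply/seteqP; split=> // k _; exists (pickle k).+1 => //=; exact: ltnSn.
rewrite probability_setT => /cvgrPdist_le/(_ e e0)[N _ /(_ N (leqnn N))].
by rewrite -KE ler_norml => /andP[_ h]; exists N; move: h; rewrite /=; lra.
Qed.

(** Truncate [f] to finitely many points that carry all but [de] of the limiting
mass. The truncated means converge, and the error of truncation is at most [D]
times the mass outside, for the limit and eventually for the laws of [X n]. *)
Lemma cvg_mean_bounded (f : 'rV[nat]_d -> R) (M : R) :
  (forall k, `|f k| <= M) ->
  \int[P]_w f (X n w) @[n --> \oo] --> \int[mu]_k f k.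
Proof.
move=> fM; apply/cvgrPdist_le => e e0.
have M0 : 0 <= M by rewrite (le_trans _ (fM 0)).
pose D := M + 1; have D0 : 0 < D by rewrite ltr_wpDl.
(* D * de is a quarter of e: one quarter for the truncated means, one for the
   tail of mu, two for the tails of the laws of X n *)
pose de := e / D / 4; have de0 : 0 < de by rewrite !divr_gt0.
have [N KN] := tightness de0.
pose q k : R := if (@pickle 'rV[nat]_d k < N)%N then 1 else 0.
pose g k := if (@pickle 'rV[nat]_d k < N)%N then f k else 0.
have [bq cq] : cvg_mean q := cvg_mean_finite (fun=> 1) N.
have [bg cg] : cvg_mean g := cvg_mean_finite f N.
have bf : exists M, forall k, `|f k| <= M by exists M.
have tail k : `|f k - g k| <= D * (1 - q k).
  rewrite /g /q; case: ifP => _; first by rewrite !subrr normr0 mulr0.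
  by rewrite !subr0 mulr1 (le_trans (fM k))// lerDl.
have bound dsp' (T' : measurableType dsp') (Q : probability T' R)
    (Y : T' -> 'rV[nat]_d) : measurable_fun setT Y ->
    `|\int[Q]_w f (Y w) - \int[Q]_w g (Y w)| <= D * (1 - \int[Q]_w q (Y w)).
  move=> mY.
  have bY (phi : 'rV[nat]_d -> R) : (exists M, forall k, `|phi k| <= M) ->
      bounded_measurable (fun w => phi (Y w)).
    move=> [C phiC]; split; last by exists C.
    exact: (@measurableT_comp _ _ _ _ _ _ phi).
  have bD : bounded_measurable (fun _ : T' => D).
    by split; [exact: measurable_cst|exists `|D|].
  have -> : D * (1 - \int[Q]_w q (Y w)) = \int[Q]_w (- D * q (Y w) + D).
    by rewrite Rintegral_lin ?Rintegral_cst1//; [lra|exact: bY].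
  apply: dist_Rintegral_le; [exact: bY|exact: bY| |].
    by apply: bounded_measurable_lin => //; exact: bY.
  by move=> w; rewrite (le_trans (tail _))//; lra.
have bmu_q := bound _ _ mu id (@measurable_id _ _ setT).
have e4 : 0 < e / 4 by rewrite divr_gt0.
move/cvgrPdist_le : cq => /(_ _ de0) cq; move/cvgrPdist_le : cg => /(_ _ e4) cg.
near=> n.
have qn : `|\int[mu]_k q k - \int[P]_w q (X n w)| <= de by near: n.
have gn : `|\int[mu]_k g k - \int[P]_w g (X n w)| <= e / 4 by near: n.
have bn := bound _ _ P (X n) (measurable_funPT _).
have Dde : D * de = e / 4 by rewrite /de mulrA mulrCA mulfV ?mulr1// gt_eqF.
move: KN; rewrite -/(Rintegral _ _ _) => KN.
have t1 : D * (1 - \int[mu]_k q k) <= e / 4.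
  by rewrite -Dde ler_wpM2l ?(ltW D0)//; move: KN; rewrite -/q; lra.
have t2 : D * (1 - \int[P]_w q (X n w)) <= e / 4 + e / 4.
  rewrite -Dde -mulrDr ler_wpM2l ?(ltW D0)//.
  by move: KN qn; rewrite ler_norml => h /andP[h1 h2]; lra.
have := le_trans bn t2; have := le_trans bmu_q t1.
move: gn; rewrite !ler_norml => /andP[? ?] /andP[? ?] /andP[? ?].
by apply/andP; split; lra.
Unshelve. all: by end_near. Qed.

End continuity.

(** * The limit law *)

Lemma cvg_mx_entry (R : realType) (p q : nat) (A : nat -> 'M[R]_(p, q))
    (L : 'M[R]_(p, q)) i k :
  A n @[n --> \oo] --> L -> A n i k @[n --> \oo] --> L i k.
Proof.
move=> AL.
have := @coord_continuous R p q i k L.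
by move=> cont; apply: (@cvg_comp _ _ _ A (fun M : 'M[R]_(p, q) => M i k) _ _ _ AL).
Qed.

Theorem theorem4 (R : realType) (dsp : measure_display)
    (T : measurableType dsp) (P : probability T R)
    (d : nat) (d_gt0 : (0 < d)%N)
    (N : 'rV[R]_d -> R) (N_norm : is_norm N)
    (xi : nat -> nat -> 'I_d -> {RV P >-> 'rV[nat]_d})
    (eps X : nat -> {RV P >-> 'rV[nat]_d})
    (X_GWI : is_GWI xi eps X)
    (xi_Be : Bernoulli_offspring xi) (eps_Be : Bernoulli_immigration eps)
    (B : nat -> 'M[R]_d) (m : nat -> 'rV[R]_d)
    (BE : forall n, (0 < n)%N -> B n = offspring_mean xi n)
    (mE : forall n, (0 < n)%N -> m n = immigration_mean eps n)
    (I1 : B n @[n --> \oo] --> (1%:M : 'M[R]_d))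
    (I2 : exists n0, forall n, (n0 <= n)%N -> opnorm N (B n) < 1)
    (I3 : forall j, (0 < j)%N -> opnorm N (mean_prod B j n) @[n --> \oo] --> 0)
    (I4 :
      (exists n0,
         (ereal_sup [set (opnorm N (1%:M - B n) / (1 - opnorm N (B n)))%:E
                    | n in [set n | (n0 <= n)%N]] < +oo)%E
         \/ (forall n j, (n0 <= n)%N -> (1 <= j <= n)%N ->
               forall i k, 0 <= A_mx B j n i k))
      \/
      (exists (U : 'M[R]_d) (rho : nat -> 'rV[R]_d), U *m U^T = 1%:M /\
         forall n, (0 < n)%N -> B n = U *m diag_mx (rho n) *m U^T))
    (lam : 'rV[R]_d)
    (M : m n *m invmx (1%:M - B n) @[n --> \oo] --> lam) :
  cvg_in_distribution X (Poisson lam).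
Proof.
have I1e i k : B n i k @[n --> \oo] --> (1%:M : 'M[R]_d) i k.
  exact: cvg_mx_entry.
have opB : \forall n \near \oo, opnorm N (B n) < 1.
  by case: I2 => n0 n0P; exists n0.
have [K K0 entryK] := entry_le_opnorm N_norm.
have I3e j : (0 < j)%N -> forall i k, mean_prod B j n i k @[n --> \oo] --> 0.
  move=> j0 i k; apply: norm_cvg0.
  apply: (@squeeze_cvgr _ _ _ _ (fun=> 0)
    (fun n => K * opnorm N (mean_prod B j n))); last 2 first.
  - exact: cvg_cst.
  - by rewrite -(mulr0 K); apply: cvgMr; exact: I3.
  by apply: nearW => n; rewrite normr_ge0 entryK.
have unit : \forall n \near \oo, 1%:M - B n \in unitmx.
  by apply: filterS opB => n; exact: unitmx_subr_opnorm.
have bA : bounded_A_sums B.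
  case: I4 => [[n0 [supfin|A0]]|[U [rho [UU BU]]]].
  - pose F n := opnorm N (1%:M - B n) / (1 - opnorm N (B n)).
    pose s := ereal_sup [set (F n)%:E | n in [set n | (n0 <= n)%N]].
    have Fs n : (n0 <= n)%N -> ((F n)%:E <= s)%E.
      by move=> n0n; apply: ereal_sup_ubound; exists n.
    apply: (@bounded_A_sums_opnorm _ _ _ N N_norm (fine s)) => //.
    exists n0 => // n /= n0n; rewrite -lee_fin fineK; first exact: Fs.
    rewrite fin_numElt supfin andbT.
    exact: lt_le_trans (ltNyr _) (Fs n0 (leqnn _)).
  - apply: bounded_A_sums_nonneg => //.
    by exists n0 => // n /= n0n j jn i k; exact: A0.
  - exact: (bounded_A_sums_diag N_norm I1e opB UU BU).
have Me k : (m n *m invmx (1%:M - B n)) 0 k @[n --> \oo] --> lam 0 k.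
  exact: cvg_mx_entry.
have sums := cvg_mean_sum I3e unit Me bA.
have m0 k : m n 0 k @[n --> \oo] --> 0.
  rewrite [X in _ --> X](_ : 0 = \sum_(i < d) lam 0 i *
      ((1%:M : 'M[R]_d) i k - (1%:M : 'M[R]_d) i k)); last first.
    by rewrite big1// => i _; rewrite subrr mulr0.
  (* m n is the product of a convergent sequence with 1%:M - B n --> 0 *)
  have cv : \sum_(i < d) (m n *m invmx (1%:M - B n)) 0 i *
      ((1%:M : 'M[R]_d) i k - B n i k) @[n --> \oo] -->
      \sum_(i < d) lam 0 i * ((1%:M : 'M[R]_d) i k - (1%:M : 'M[R]_d) i k).
    apply: cvg_sumr => i _; apply: cvgM; first exact: Me.
    by apply: cvgB; [exact: cvg_cst|exact: I1e].
  apply: cvg_trans cv; apply: near_eq_cvg; near=> n.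
  have un : 1%:M - B n \in unitmx by near: n.
  rewrite -[in RHS](mulmxKV un (m n)) [RHS]mxE; apply: eq_bigr => i _.
  by congr (_ * _); rewrite !mxE.
have a01 (y : 'cV[R]_d) : (forall i, 0 <= y i 0 <= 1) ->
    forall j n, (0 < j <= n)%N -> 0 <= (m j *m mean_prod B j n *m y) 0 0 <= 1.
  move=> y01 j n /andP[j0 jn]; rewrite -mulmxA.
  apply: (itv_immigration_mean eps_Be mE) => //.
  exact: (itv_mean_prod X_GWI xi_Be BE).
(* a limit of nonnegative sums; Poisson_mono requires it *)
have lam0 k : 0 <= lam 0 k.
  have : \sum_(1 <= j < n.+1) (m j *m mean_prod B j n) 0 k @[n --> \oo]
      --> lam 0 k by exact: sums.
  move=> h; apply: (cvgr_to_ge h); apply: nearW => n.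
  rewrite big_nat_cond sumr_ge0// => j /andP[jn _].
  rewrite (_ : _ 0 k = (m j *m mean_prod B j n *m (delta_mx k 0 : 'cV[R]_d)) 0 0).
    have d01 i : 0 <= (delta_mx k 0 : 'cV[R]_d) i 0 <= 1.
      by rewrite mxE eqxx andbT; case: eqP; rewrite ?lexx ?ler01.
    by case/andP: (a01 _ d01 j n jn).
  by rewrite -colE [RHS]mxE.
have pgf_cvg (y : 'cV[R]_d) : (forall i, 0 <= y i 0 <= 1) ->
    pgf B m n y @[n --> \oo] --> expR (- (lam *m y) 0 0).
  move=> y01.
  apply: (@cvg_prod_expR _ (fun j n => (m j *m mean_prod B j n *m y) 0 0)
    (* the total immigration mass dominates, as B_[j,n] y is in [0, 1]^d *)
    (fun j => \sum_(k < d) m j 0 k)).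
  - exact: a01.
  - move=> j n /andP[j0 jn]; rewrite -mulmxA mxE; apply: ler_sum => k _.
    rewrite ler_piMr//; first exact: (immigration_mean_ge0 eps_Be mE).
    by have /andP[] := itv_mean_prod X_GWI xi_Be BE jn y01 k.
  - rewrite [X in _ --> X](_ : 0 = \sum_(k < d) 0); last by rewrite big1.
    by apply: cvg_sumr => k _; exact: m0.
  - move=> j j0.
    rewrite [X in _ --> X](_ : 0 = \sum_(k < d)
      (\sum_(i < d) m j 0 i * 0) * y k 0); last first.
      by rewrite big1// => k _; rewrite big1 ?mul0r// => i _; rewrite mulr0.
    rewrite (_ : (fun n => _) = (fun n => \sum_(k < d)
      (\sum_(i < d) m j 0 i * mean_prod B j n i k) * y k 0)); last first.
      by apply/funext => n; rewrite mxE; apply: eq_bigr => k _; rewrite mxE.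
    apply: cvg_sumr => k _; apply: cvgMl; apply: cvg_sumr => i _.
    by apply: cvgMr; exact: I3e.
  - rewrite mxE.
    rewrite (_ : (fun n => _) = (fun n => \sum_(k < d)
      (\sum_(1 <= j < n.+1) (m j *m mean_prod B j n) 0 k) * y k 0)).
      by apply: cvg_sumr => k _; apply: cvgMl; exact: sums.
    apply/funext => n; under [RHS]eq_bigr do rewrite mulr_suml.
    by rewrite exchange_big/=; apply: eq_bigr => j _; rewrite mxE.
move=> f _ [C fC].
have fC' k : `|f (real_rV R k)| <= C by exact: fC.
have E n : 'E_P[fun w => f (real_rV R (X n w))]%E =
    (\int[P]_w f (real_rV R (X n w)))%:E.
  rewrite EFin_Rintegral ?unlock//.
  exact: (bounded_measurable_rv (X n) fC').
rewrite (_ : (fun n => _) = (fun n => (\int[P]_w f (real_rV R (X n w)))%:E));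
  last exact/funext.
rewrite -EFin_Rintegral; last by split=> //; exists C.
apply: cvg_EFin; first exact: nearW.
apply: cvg_mean_bounded fC' => y y01.
have y01' i : 0 <= y i 0 <= 1 by case/andP: (y01 i) => -> /ltW.
rewrite Poisson_mono//.
rewrite (_ : (fun n => _) = (fun n => pgf B m n y)); first exact: pgf_cvg.
by apply/funext => n; rewrite (gwi_pgf X_GWI xi_Be eps_Be BE mE).
Unshelve. all: by end_near. Qed.
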